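(* Let $n\ge 1$ and let $\Delta^n$ be the $n$-simplex (with all its faces). The complex $\mathcal{SM}(\Delta^n)$ of strong discrete Morse matchings on $\Delta^n$ collapses (simplicially) to a subcomplex $X_n$ of dimension $n-1$ that is isomorphic to the complex of directed forests $\Delta(G_{n+1})$, where $G_{n+1}$ is the complete directed graph on $n+1$ vertices. Consequently, $\mathcal{SM}(\Delta^n)$ has the homotopy type of a wedge of $n^n$ copies of $\mathbb{S}^{n-1}$.
   Context: All simplicial complexes are finite. For a simplicial complex $K$ and a vertex $v$, the link $\mathrm{lk}(v,K)$ consists of the simplices $\sigma$ of $K$ with $v\notin\sigma$ and $\sigma\cup\{v\}\in K$. A vertex $v$ is dominated by a vertex $a\ne v$ in $K$ if $\mathrm{lk}(v,K)=a*K_0$ is a simplicial cone with apex $a$ (over a possibly empty subcomplex $K_0$). A vertex filtration is an injective map $g:V(K)\to\mathbb{R}$; $K_{g(v)}$ denotes the full subcomplex of $K$ on the vertices $w$ with $g(w)\le g(v)$. The vertex $v$ is descending dominated by $a$ if $v$ is dominated by $a$ in $K_{g(v)}$ (so $g(a)<g(v)$). A strong Morse matching associated with $g$ is obtained by choosing, for every descending dominated vertex $v$, one vertex $a_v$ dominating it in $K_{g(v)}$, and taking the set of all pairs $(\sigma,\sigma\cup\{a_v\})$ where $\sigma$ is a simplex of $K_{g(v)}$ with $v\in\sigma$ and $a_v\notin\sigma$; vertices that are not descending dominated contribute no pairs. A strong Morse matching on $K$ is one associated with some vertex filtration (and some choices). The complex $\mathcal{SM}(K)$ is the simplicial complex whose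 simplices are all nonempty subsets of strong Morse matchings on $K$ (so its vertices are the pairs $(\sigma,\tau)$, $\sigma$ a codimension-one face of $\tau$, occurring in some strong Morse matching). Directed forests: a directed graph $G$ is a directed tree with root $x\in V(G)$ if for every $y\in V(G)$ there is a unique directed path from $x$ to $y$. It is a directed forest if its vertex set decomposes as a disjoint union of sets $A_i$ such that each $A_i$ induces a directed tree and there are no edges between $A_i$ and $A_j$ for $i\neq j$. For a directed graph $G$, $\Delta(G)$ is the simplicial complex whose vertices are the directed edges of $G$ and whose faces are (the edge sets of) all directed forests that are subgraphs of $G$. The complete directed graph $G_m$ on $m$ vertices has one edge in each direction between every pair of distinct vertices, hence $m(m-1)$ edges. *)

(* Defs.v *)
From HB Require Import structures.
From mathcomp Require Import all_boot all_order all_algebra.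
From mathcomp Require Import boolp reals.
Set Implicit Arguments.
Unset Strict Implicit.
Unset Printing Implicit Defensive.
Import Order.TTheory GRing.Theory Num.Theory.
Local Open Scope ring_scope.

Section SimplicialComplexes.
Variable V : finType.
Implicit Types (K L : {set {set V}}) (s t : {set V}) (v w a : V).

(* A complex is given by its set of nonempty simplices; its vertices are the   *)
(* v with [set v] \in K, which need not be all of V.                           *)
Definition is_complex K : Prop :=
  set0 \notin K /\
  forall s t, s \in K -> t \subset s -> t != set0 -> t \in K.

Definition is_subcomplex L K : Prop := is_complex L /\ L \subset K.

Definition vertices K : {set V} := [set v | [set v] \in K].

Definition has_dim K (d : nat) : Prop :=
  (exists2 s : {set V}, s \in K & #|s| = d.+1) /\
  (forall s, s \in K -> (#|s| <= d.+1)%N).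

Definition elementary_collapse K L : Prop :=
  exists s t : {set V},
    [/\ s \in K, t \in K, s \subset t /\ #|t| = #|s|.+1,
        forall u, u \in K -> s \subset u -> u = s \/ u = t
      & L = K :\: [set s; t]].

Inductive collapses K : {set {set V}} -> Prop :=
| collapses_refl : collapses K K
| collapses_step L M :
    collapses K L -> elementary_collapse L M -> collapses K M.

Definition link v K : {set {set V}} :=
  [set s in K | (v \notin s) && (v |: s \in K)].

(* The simplicial cone a * K0. *)
Definition cone a K0 : {set {set V}} :=
  [set a] |: (K0 :|: [set a |: s | s in K0]).

Definition dominated K v a : Prop :=
  a != v /\
  exists K0 : {set {set V}},
    [/\ is_subcomplex K0 K, a \notin vertices K0 & link v K = cone a K0].

End SimplicialComplexes.

Definition isomorphic (V W : finType)
    (K : {set {set V}}) (L : {set {set W}}) : Prop :=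
  exists f : V -> W,
    [/\ {in vertices K &, injective f},
        f @: vertices K = vertices L
      & forall s : {set V}, s \subset vertices K -> (f @: s \in L) = (s \in K)].

Definition full_simplex (V : finType) : {set {set V}} := [set s | s != set0].

Section StrongMorseMatchings.
Variables (R : realType) (V : finType) (K : {set {set V}}).
Implicit Types (g : V -> R) (v a : V) (c : V -> V).

(* Only the values of g on the vertices of K are relevant. *)
Definition vertex_filtration g : Prop := {in vertices K &, injective g}.

Definition sublevel g v : {set {set V}} :=
  [set s in K | [forall w in s, g w <= g v]].

Definition descending_dominated_by g v a : Prop := dominated (sublevel g v) v a.

Definition descending_dominated g v : Prop :=
  exists a, descending_dominated_by g v a.

(* c v is the chosen a_v; its value is irrelevant when v is not descending     *)
(* dominated.                                                                  *)
Definition dominating_choice g c : Prop :=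
  forall v, descending_dominated g v -> descending_dominated_by g v (c v).

Definition associated_matching g c : {set {set V} * {set V}} :=
  [set p | `[< exists v, [/\ descending_dominated g v, p.1 \in sublevel g v,
                            v \in p.1, c v \notin p.1 & p.2 = c v |: p.1] >]].

Definition strong_morse_matching (M : {set {set V} * {set V}}) : Prop :=
  exists g c, [/\ vertex_filtration g, dominating_choice g c
                & M = associated_matching g c].

Definition SM : {set {set {set V} * {set V}}} :=
  [set S | (S != set0) &&
           `[< exists2 M : {set {set V} * {set V}}, strong_morse_matching M & S \subset M >]].

End StrongMorseMatchings.

Section DirectedForests.
Variable T : finType.

Record digraph := Digraph {
  dvert : {set T};
  darc : {set T * T};
  darcP : forall e, e \in darc -> (e.1 \in dvert) && (e.2 \in dvert)
}.
Implicit Types (G H : digraph) (A B : {set T}).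

Definition subdigraph H G : Prop := dvert H \subset dvert G /\ darc H \subset darc G.

Fact inducedP G A e :
  e \in [set e in darc G | (e.1 \in A) && (e.2 \in A)] ->
  (e.1 \in dvert G :&: A) && (e.2 \in dvert G :&: A).
Proof.
by rewrite !inE => /and3P[/darcP/andP[-> ->] -> ->].
Qed.

Definition induced G A : digraph := Digraph (@inducedP G A).

(* x :: p is the vertex sequence of the path. Vertices may repeat in it: with  *)
(* unique vertex-simple paths instead, the 2-cycle x -> y -> x would be a tree. *)
Definition directed_path G (x y : T) (p : seq T) : Prop :=
  path (fun u w => (u, w) \in darc G) x p /\ last x p = y.

Definition directed_tree G (x : T) : Prop :=
  x \in dvert G /\
  forall y, y \in dvert G -> exists! p : seq T, directed_path G x y p.

Definition directed_forest G : Prop :=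
  exists P : {set {set T}},
    [/\ partition P (dvert G),
        forall A, A \in P -> exists x, directed_tree (induced G A) x
      & forall A B, A \in P -> B \in P -> A != B ->
          forall x y, x \in A -> y \in B -> (x, y) \notin darc G].

(* As for every complex here, the empty face is left out. *)
Definition forest_complex G : {set {set T * T}} :=
  [set E | (E != set0) &&
           `[< exists H, [/\ subdigraph H G, directed_forest H & darc H = E] >]].

End DirectedForests.

Fact complete_digraphP m (e : 'I_m * 'I_m) :
  e \in [set e : 'I_m * 'I_m | e.1 != e.2] ->
  (e.1 \in [set: 'I_m]) && (e.2 \in [set: 'I_m]).
Proof. by rewrite !inE. Qed.

Definition complete_digraph m : digraph 'I_m := Digraph (@complete_digraphP m).

From mathcomp Require Import mathcomp_extra classical_sets functions set_interval.
From mathcomp Require Import topology normedtype homotopy.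
Import numFieldNormedType.Exports.
Local Open Scope classical_set_scope.

Section Homotopy.
Variable R : realType.

Definition homotopic (X Y : topologicalType) (f g : X -> Y) : Prop :=
  exists H : X * R -> Y,
    [/\ {within [set: X] `*` `[0 : R, 1], continuous H},
        forall x, H (x, 0) = f x & forall x, H (x, 1) = g x].

Definition homotopy_equivalent (X Y : topologicalType) : Prop :=
  exists (f : X -> Y) (g : Y -> X),
    [/\ continuous f, continuous g,
        homotopic (g \o f) idfun & homotopic (f \o g) idfun].

(* Barycentric coordinates; the topology is that of a subspace of the product  *)
(* R^V, which is the usual one since V is finite.                              *)
Definition barycentric (V : finType) (K : {set {set V}}) :
    set {ptws V -> R} :=
  [set x | [/\ forall v, 0 <= x v, \sum_v x v = 1
             & finset (fun v => x v != 0) \in K]].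

Definition realization (V : finType) (K : {set {set V}}) : topologicalType :=
  set_type (barycentric K).

(* The unit sphere of dimension d, in R^(d+1). *)
Definition sphere (d : nat) : set 'rV[R]_d.+1 :=
  [set x | \sum_i x 0 i ^+ 2 = 1].
Arguments sphere : clear implicits.

Fact sphere_pole d : delta_mx 0 0 \in sphere d.
Proof.
apply/mem_set; rewrite /sphere /= (bigD1 ord0) //= mxE !eqxx expr1n.
rewrite big1 ?addr0 // => i /negPf i0.
by rewrite mxE i0 andbF expr0n.
Qed.

Definition sphere_point (d : nat) : sphere d :=
  exist (fun x => x \in sphere d) _ (sphere_pole d).

Definition wedge_of_spheres (k d : nat) : topologicalType :=
  wedge (fun _ : 'I_k => sphere_point d).

End Homotopy.

Arguments sphere R d : clear implicits.
Arguments sphere_point R d : clear implicits.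
Arguments barycentric R {V} K _.
Arguments realization R {V} K.

(* Main.v *)
From HB Require Import structures.
From mathcomp Require Import all_boot all_order all_algebra.
From mathcomp Require Import zify ring lra boolp reals.
Require Import Defs.
Set Implicit Arguments.
Unset Strict Implicit.
Unset Printing Implicit Defensive.
Import Order.TTheory GRing.Theory Num.Theory.

(* A set S of pairs (s, a |: s) lies in a strong Morse matching iff the        *)
(* vertices can be removed one after the other so that each removed vertex v   *)
(* is not the vertex a added by a remaining pair, and all remaining pairs with *)
(* v in s add the same vertex. Removing at each step all vertices that can be  *)
(* removed gives every S a canonical layering, which becomes pointwise smaller *)
(* when S shrinks and does not change when one toggles ({v}, {a, v}), for v    *)
(* the first removed vertex of a pair (s, a |: s) of S with #|s| > 1. Toggling *)
(* these elements collapses SM to the S all of whose pairs are of the form     *)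
(* ({v}, {a, v}): these are the directed forests, with arcs a -> v.            *)
(* Fixing a vertex z, the forests are matched by toggling the first arc z -> v *)
(* that may be added. This collapses all forests but the spanning trees in     *)
(* which z is a childless non-root to one vertex; there are n^n such trees, by *)
(* Cayley's formula, and they are facets of dimension n-1. Attaching k facets  *)
(* of dimension d to a contractible complex gives a wedge of k d-spheres.      *)

(** In a simplex every link is a simplex, hence a cone over each of its vertices
    ([descending_dominated_full]). A strong Morse matching is therefore an ordering of the vertices
    together with, for each vertex v but the lowest, a lower vertex a_v: every face with top vertex
    v that avoids a_v is paired with its union with a_v. So a set S of pairs lies in a matching
    exactly when such an ordering can be built from the top downwards, which the greedy procedure
    behind [eliminated] decides; this is [SM_full_simplex].

    If S contains a pair (s, a |: s) in which v is the top vertex of s, then ({v}, {a, v}) asks for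
    nothing that this pair does not ask already, so it may be added or deleted freely. Choosing v
    canonically turns these moves into an acyclic matching on all S having a pair with more than one
    vertex in s. Its acyclicity comes from a monotone key ([elim_key_mono]), and [collapses_toggle]
    makes a collapse out of it ([elim_complex_collapses]). For the remaining S, elimination means
    that the arcs a -> v have in-degree at most one and no cycle: [star_complex_forests] and
    [forest_complex_complete] identify them with directed forests.

    For the homotopy type, [noncritical_collapses] shows that the forest complex without its
    critical forests collapses to a vertex. The critical forests are facets with n arcs
    ([card_critical_face]), and there are n^n of them ([card_critical]), by a Cayley-type count of
    rooted trees ([card_flow]). In [attached_facets_wedge] the contraction of the rest is extended
    over these facets, so the rest may be shrunk to a point; each open facet is a punctured sphere
    through [facet_sphere], and the quotient is the wedge. Since collapses are homotopy equivalences
    ([collapses_equivalent]), this is also the homotopy type of the whole complex. *)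

(** * Collapses *)

Section Collapses.
Variable V : finType.
Implicit Types (K L M : {set {set V}}) (s t u : {set V}).

Lemma collapses_trans K L M : collapses K L -> collapses L M -> collapses K M.
Proof. by move=> KL; elim=> // L' M' _; apply: collapses_step. Qed.

Lemma collapses_subset K L : collapses K L -> L \subset K.
Proof.
elim=> // {}L M _ LK [s [t [_ _ _ _ ->]]].
by apply: subset_trans LK; apply: subsetDl.
Qed.

Lemma elementary_collapse_complex K L :
  is_complex K -> elementary_collapse K L -> is_complex L.
Proof.
move=> [K0 Kd] [s [t [sK tK [st _] free ->]]]; split=> [|u w].
  by rewrite inE negb_and K0 orbT.
rewrite !inE negb_or => /andP[/andP[us ut] uK] wu w0.
rewrite (Kd u w) // andbT; apply/norP; split; apply: contraNneq us => ew.
  by have [] := free u uK; [rewrite -ew|move=> ->|move=> eut; rewrite eut eqxx in ut].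
have [] := free u uK; first by apply: subset_trans st _; rewrite -ew.
  by move=> ->.
by move=> eut; rewrite eut eqxx in ut.
Qed.

Lemma collapses_complex K L : is_complex K -> collapses K L -> is_complex L.
Proof.
by move=> Kc; elim=> // {}L M _ Lc; apply: elementary_collapse_complex.
Qed.

(* Faces of maximal key come in pairs [s, x |: s]; among them a pair whose     *)
(* larger face has maximal size is an elementary collapse.                     *)
Lemma collapses_toggle K L (key : {set V} -> nat) (x : {set V} -> V) :
    set0 \notin K -> is_complex L -> L \subset K ->
    {in K :\: L &, forall s t, s \subset t ->
       (key s <= key t)%N /\ (key s = key t -> x s = x t)} ->
    {in K :\: L, forall s,
       [/\ x s |: s \in K :\: L, s :\ x s \in K :\: L,
           key (x s |: s) = key s & key (s :\ x s) = key s]} ->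
  collapses K L.
Proof.
move=> + [L0 Ld].
have [m] := ubnP #|K :\: L|; elim: m K => // m IHm K leKm K0 LK mono tog.
have [e|[t0 t0K]] := set_0Vmem (K :\: L).
  suff -> : K = L by left.
  by apply/eqP; rewrite eqEsubset LK andbT -setD_eq0 e.
pose B := #|V|.+1.
have cardB u : (#|u| < B)%N by rewrite ltnS max_card.
(* As sizes are below B, this maximizes the pair (key, size) lexicographically. *)
have [t tK tmax] : exists2 t, t \in K :\: L &
    {in K :\: L, forall u, (key u * B + #|u| <= key t * B + #|t|)%N}.
  by case: (arg_maxnP (fun u => key u * B + #|u|)%N t0K) => t tK tmax; exists t.
have keymax u : u \in K :\: L -> (key u <= key t)%N.
  move=> uK; have := tmax u uK; have := cardB u; have := cardB t.
  by rewrite leqNgt => ct cu h; apply/negP => lt; nia.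
have cardmax u : u \in K :\: L -> key u = key t -> (#|u| <= #|t|)%N.
  by move=> uK e; have := tmax u uK; rewrite e leq_add2l.
have [xtK sK kxt ks] := tog t tK.
set s := t :\ x t in sK ks.
have xt : x t \in t.
  have := cardmax _ xtK kxt; rewrite cardsU1.
  by case: (x t \in t) => //=; rewrite ltnn.
have ets : x t |: s = t by rewrite setD1K.
have xs : x s = x t by case: (mono s t sK tK) => [|_]; [apply: subD1set|apply].
have tsize : #|t| = #|s|.+1 by rewrite (cardsD1 (x t)) xt.
(* A face above s has the maximal key too, so it toggles the same vertex as t; the maximal size of t
   then leaves only s and t. *)
have free u : u \in K -> s \subset u -> u = s \/ u = t.
  move=> uK su.
  have uKL : u \in K :\: L.
    rewrite !inE uK andbT; move: sK; rewrite !inE => /andP[sL sKK].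
    apply: contra sL => uL; apply: Ld uL su _.
    by apply: contraNneq K0 => <-.
  have [kle kx] := mono s u sK uKL su.
  have kut : key u = key t by apply/eqP; rewrite eqn_leq keymax //= -ks.
  have xu : x u = x t by rewrite -xs kx // ks.
  have [xuK _ kxu _] := tog u uKL.
  have ule := cardmax _ uKL kut.
  have [xin|xnin] := boolP (x t \in u).
    right; apply/esym/eqP; rewrite eqEcard ule andbT -ets.
    by rewrite subUset sub1set xin.
  left; apply/esym/eqP; rewrite eqEcard su /=.
  have := cardmax _ xuK; rewrite kxu => /(_ kut).
  by rewrite xu cardsU1 xnin tsize.
have inKL u : u \in K :\: L -> (u \in K) /\ (u \notin L).
  by rewrite inE => /andP[].
have [[tKK tL] [sKK sL]] := (inKL t tK, inKL s sK).
have step : elementary_collapse K (K :\: [set s; t]).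
  exists s, t; split => //; split; last by rewrite tsize.
  by rewrite subD1set.
have KL' : (K :\: [set s; t]) :\: L = (K :\: L) :\: [set s; t].
  by apply/setP => u; rewrite !inE andbCA.
apply: (collapses_trans (collapses_step (collapses_refl K) step)).
apply: IHm.
- rewrite KL' -ltnS; apply: leq_trans leKm; rewrite ltnS.
  rewrite [X in (_ < X)%N](cardsD1 t) tK add1n ltnS subset_leq_card //.
  by apply/subsetP=> u; rewrite !inE negb_or => /andP[/andP[_ ->] ->].
- by rewrite inE negb_and K0 orbT.
- apply/subsetP=> u uL; rewrite !inE (subsetP LK) // andbT negb_or.
  by apply/andP; split; apply: contraTneq uL => ->.
- move=> u v uK vK; apply: mono.
    by move: uK; rewrite KL' inE => /andP[].
  by move: vK; rewrite KL' inE => /andP[].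
move=> u; rewrite KL' in_setD => /andP[ust uK].
have [a1 a2 a3 a4] := tog u uK.
move: ust; rewrite in_set2 negb_or => /andP[us ut].
(* If the partner of u were s or t, then u would toggle [x t] and be one of s and t itself. *)
have nst w : w \in K :\: L -> key w = key u ->
    (w = x u |: u \/ w = u :\ x u) -> (w != s) && (w != t).
  move=> wK kw hw.
  suff H : w = s \/ w = t -> x u = x t.
    apply/andP; split; apply/negP => /eqP e.
      have xu := H (or_introl e); case: hw => hw.
        have : x t \in s by rewrite -e hw xu setU11.
        by rewrite !inE eqxx.
      have [xin|xnin] := boolP (x u \in u).
        by case/eqP: ut; rewrite -ets -e hw -xu setD1K.
      by case/eqP: us; rewrite -e hw; apply/setP => z; rewrite !inE;
         case: eqP => // ->; rewrite (negPf xnin).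
    have xu := H (or_intror e); case: hw => hw.
      have [xin|xnin] := boolP (x u \in u).
        by case/eqP: ut; rewrite -e hw; apply/setP => z; rewrite !inE;
         case: eqP => // ->; rewrite xin.
      by case/eqP: us; rewrite /s -xu -e hw setU1K.
    by have : x t \in w by [rewrite e]; rewrite hw xu !inE eqxx.
  have xw : x w = x u.
    case: hw => e.
      by case: (mono u w uK wK) => [|_ ->] //; rewrite e subsetUr.
    by case: (mono w u wK uK) => [|_ ->] //; rewrite e subD1set.
  by case=> e; rewrite -xw e.
split=> //; rewrite in_setD ?a1 ?a2 andbT !inE negb_or nst //.
  by left.
by right.
Qed.

End Collapses.

(** * Transport of collapses along injective vertex maps *)

Section CollapseImage.
Variables (V W : finType) (f : V -> W).
Hypothesis f_inj : injective f.

Definition image_complex (K : {set {set V}}) : {set {set W}} :=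
  [set f @: s | s : {set V} in K].

Lemma mem_image_complex (K : {set {set V}}) (s : {set V}) :
  (f @: s \in image_complex K) = (s \in K).
Proof. exact/mem_imset/imset_inj. Qed.

Lemma collapses_image (K L : {set {set V}}) :
  collapses K L -> collapses (image_complex K) (image_complex L).
Proof.
elim=> [|{}L M _ IH [s [t [sL tL [st cst] free ->]]]]; first by left.
apply: collapses_step IH _.
exists (f @: s), (f @: t); rewrite !mem_image_complex !card_imset //; split=> //.
- by split=> //; rewrite imsetS.
- move=> _ /imsetP[u uL ->] su.
  have /(free u uL) [->|->] : s \subset u; [|by left|by right].
  apply/subsetP => v vs; rewrite -(mem_imset u v f_inj).
  by rewrite (subsetP su) ?imset_f.
apply/setP => w; rewrite !inE; apply/imsetP/andP => [[u]|[+ /imsetP[u uL ew]]].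
  rewrite !inE negb_or => /andP[/andP[us ut] uL] ->.
  by rewrite mem_image_complex uL !(inj_eq (imset_inj f_inj)) (negPf us) (negPf ut).
rewrite ew !(inj_eq (imset_inj f_inj)) => h; exists u => //.
by rewrite !inE h.
Qed.

End CollapseImage.

(** * Eliminating vertices from the top *)

(** This lets [rank], the number of rounds survived, decide membership in each layer. *)
Lemma sum_decreasing_bool (N k : nat) (b : nat -> bool) :
    (forall i j, (i <= j)%N -> b j -> b i) -> ~~ b N ->
  b k = (k < \sum_(j < N) b j)%N.
Proof.
elim: N k b => [|N IHN] k b dec bN.
  by rewrite big_ord0 ltn0; apply/negbTE; apply: contra bN; apply: dec.
rewrite big_ord_recl /bump /=.
have IH j := IHN j (b \o S) (fun i j ij => dec i.+1 j.+1 ij) bN.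
have [b0|b0] := boolP (b 0).
  by case: k => [|k] //; rewrite [LHS]IH.
rewrite (negPf (contra (dec 0 k isT) b0)) big1 // => i _.
by apply/eqP; rewrite eqb0; apply: contra b0; apply: dec.
Qed.

Section Elimination.
Variable I : finType.
Let P := ({set I} * {set I})%type.
Implicit Types (S T : {set P}) (W : {set I}) (p q : P) (v w : I).

Definition added p : {set I} := p.2 :\: p.1.

(** W holds the vertices not yet removed, and only pairs with p.1 inside W are still active. The
    conditions say that v may be the next top vertex: the active pairs with v in p.1 agree on what
    they add, and v itself is added by none. *)
Definition removable S W : {set I} :=
  [set v in W | [forall p in S, (p.1 \subset W) ==> (v \notin added p) &&
     [forall q in S, [&& q.1 \subset W, v \in p.1 & v \in q.1] ==>
        (added p == added q)]]].

Lemma removableP S W v :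
  reflect (v \in W /\ {in S, forall p, p.1 \subset W -> v \notin added p /\
     {in S, forall q, q.1 \subset W -> v \in p.1 -> v \in q.1 ->
        added p = added q}})
  (v \in removable S W).
Proof.
rewrite inE; apply: (iffP andP) => -[vW H]; split=> //.
  move=> p pS pW; move/forall_inP: H => /(_ p pS); rewrite pW /=.
  case/andP=> vp /forall_inP H; split=> // q qS qW vp1 vq1.
  by apply/eqP; have := H q qS; rewrite qW vp1 vq1.
apply/forall_inP => p pS; apply/implyP => pW; have [-> H'] := H p pS pW.
apply/forall_inP => q qS; apply/implyP => /and3P[qW vp1 vq1].
by apply/eqP; apply: H'.
Qed.

Fixpoint layer S k : {set I} :=
  if k is k'.+1 then layer S k' :\: removable S (layer S k') else setT.

Lemma layer_anti S k l : (k <= l)%N -> layer S l \subset layer S k.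
Proof.
elim: l => [|l IHl]; first by rewrite leqn0 => /eqP ->.
rewrite leq_eqVlt => /predU1P[->//|/IHl]; apply: subset_trans.
exact: subsetDl.
Qed.

(** Fewer pairs and fewer remaining vertices leave fewer active constraints, so a vertex that T can
    remove is removable for S as well. *)
Lemma layer_mono S T k : S \subset T -> layer S k \subset layer T k.
Proof.
move=> ST; elim: k => // k IHk; apply/subsetP => v.
rewrite /= !in_setD => /andP[vr vS]; rewrite (subsetP IHk) // andbT.
apply: contra vr => /removableP[_ H]; apply/removableP; split=> // p pS pW.
have [vp H'] := H p (subsetP ST p pS) (subset_trans pW IHk); split=> // q qS qW.
by apply: H'; [apply: (subsetP ST)|apply: subset_trans qW IHk].
Qed.

(** Whenever x is active, so is p, and p implies every constraint that x imposes. The set T allows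
    the last hypothesis to be checked on whichever of S and x |: S is known to be eliminated. *)
Lemma layer_add S T p v : let x := ([set v], v |: added p) in
    p \in S -> v \in p.1 -> T = S \/ T = x |: S ->
    (forall k, v \in layer T k -> p.1 \subset layer T k) ->
  forall k, layer (x |: S) k = layer S k.
Proof.
move=> x pS vp TS vT; elim=> // k IHk /=; rewrite IHk; congr (_ :\: _).
have Tk : layer T k = layer S k by case: TS => ->.
move/(_ k): vT; rewrite Tk; move: (layer S k) => W vW {IHk TS Tk T}.
have vNp : v \notin added p by rewrite inE vp.
have ax : added x = added p.
  by apply/setP => w; rewrite !inE; case: eqP => //= ->; rewrite vp.
apply/setP => u; apply/removableP/removableP => -[uW H]; split=> // q.
  move=> qS qW; have [|uq H'] := H q _ qW; first by rewrite inE qS orbT.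
  by split=> // r rS; apply: H'; rewrite inE rS orbT.
have repl r : r \in x |: S -> r.1 \subset W ->
    exists r', [/\ r' \in S, r'.1 \subset W, added r' = added r
                 & u \in r.1 -> u \in r'.1].
  case/setU1P => [->|rS rW]; last by exists r.
  by rewrite sub1set => /vW pW; exists p; split=> //= /set1P ->.
move=> /repl h /h[q' [qS qW qa qu]].
have [uq H'] := H q' qS qW; rewrite -qa; split=> // r.
move=> /repl h' /h'[r' [rS rW ra ru]] /qu uq' /ru ur'.
by rewrite -ra; apply: H'.
Qed.

Let N := #|I|.

(** For eliminated S, the round, counted from 1, in which v is removed. *)
Definition rank S v : nat := \sum_(k < N) (v \in layer S k).

Definition eliminated S : bool := layer S N == set0.

Lemma eliminated_sub S T : S \subset T -> eliminated T -> eliminated S.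
Proof.
by move=> ST /eqP T0; rewrite /eliminated -subset0 -T0 layer_mono.
Qed.

Lemma mem_layer S v k : eliminated S -> (v \in layer S k) = (k < rank S v)%N.
Proof.
move=> /eqP S0; apply: (@sum_decreasing_bool N k (fun k => v \in layer S k)).
  by move=> i j ij; apply: (subsetP (layer_anti S ij)).
by rewrite S0 inE.
Qed.

Lemma rank_gt0 S v : eliminated S -> (0 < rank S v)%N.
Proof. by move=> S0; rewrite -mem_layer // inE. Qed.

Lemma rank_mono S T v : S \subset T -> (rank S v <= rank T v)%N.
Proof.
move=> ST; apply: leq_sum => k _.
by case: (boolP (_ \in layer S _)) => // /(subsetP (layer_mono _ ST)) ->.
Qed.

Lemma rank_le S v : (rank S v <= N)%N.
Proof.
by rewrite -[X in (_ <= X)%N]card_ord -sum1_card leq_sum // => i _; apply: leq_b1.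
Qed.

(** A vertex of least rank in p.1 is among the first of p.1 to go, so p is still active in the round
    that removes it. *)
Lemma top_removable S p v : eliminated S -> p \in S -> v \in p.1 ->
    {in p.1, forall w, (rank S v <= rank S w)%N} ->
  v \in removable S (layer S (rank S v).-1) /\ p.1 \subset layer S (rank S v).-1.
Proof.
move=> S0 pS vp vmin; have r0 := rank_gt0 v S0; split.
  have : v \notin layer S (rank S v) by rewrite mem_layer // ltnn.
  rewrite -{1}(prednK r0) /= in_setD negb_and negbK => /orP[//|].
  by rewrite mem_layer // prednK ?leqnn.
apply/subsetP => w wp; rewrite mem_layer // prednK //; exact: vmin.
Qed.

Lemma top_added S p q v : eliminated S -> p \in S -> q \in S ->
    v \in p.1 -> v \in q.1 ->
    {in p.1, forall w, (rank S v <= rank S w)%N} ->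
    {in q.1, forall w, (rank S v <= rank S w)%N} ->
  added p = added q.
Proof.
move=> S0 pS qS vp vq vminp vminq.
have [/removableP[_ H] pW] := top_removable S0 pS vp vminp.
have [_ qW] := top_removable S0 qS vq vminq.
by have [_ H'] := H p pS pW; apply: H'.
Qed.

(** As long as p is active, w is not removable; and p is active up to and including the round that
    removes v. *)
Lemma top_notin_added S p v w : eliminated S -> p \in S ->
    v \in p.1 -> {in p.1, forall w, (rank S v <= rank S w)%N} ->
    w \in added p -> (rank S v < rank S w)%N.
Proof.
move=> S0 pS vp vmin wp; have [_ pW] := top_removable S0 pS vp vmin.
have r0 := rank_gt0 v S0.
have stay k : (k <= (rank S v).-1)%N -> w \in layer S k.+1.
  elim: k => [|k IHk] krv /=.
    rewrite in_setD in_setT andbT; apply/negP => /removableP[_ H].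
    by have [] := H p pS (subsetT _); rewrite wp.
  rewrite in_setD (IHk (ltnW krv)) andbT; apply/negP => /removableP[_ H].
  by have [] := H p pS (subset_trans pW (layer_anti S krv)); rewrite wp.
by have := stay _ (leqnn _); rewrite prednK // mem_layer.
Qed.

(** Breaks ties of [rank] by the enumeration, giving a linear order of elimination. *)
Definition height S v : nat := (rank S v * N.+1 + enum_rank v)%N.

Lemma height_inj S : injective (height S).
Proof.
move=> v w /(congr1 (modn^~ N.+1)); rewrite /height !modnMDl.
have small (u : I) : (enum_rank u < N.+1)%N.
  by rewrite ltnS; apply: ltnW; exact: (ltn_ord (enum_rank u)).
by rewrite !modn_small // => /val_inj/enum_rank_inj.
Qed.

Lemma height_rank S v w : (height S v <= height S w)%N -> (rank S v <= rank S w)%N.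
Proof.
rewrite /height leqNgt => h; rewrite leqNgt; apply: contra h => h.
have := ltn_ord (enum_rank v); have := ltn_ord (enum_rank w).
have := leq_mul h (leqnn N.+1); rewrite -/N mulSn; lia.
Qed.

Lemma height_lt S v : (height S v < N.+1 * N.+1)%N.
Proof.
have := ltn_ord (enum_rank v); have := leq_mul (rank_le S v) (leqnn N.+1).
rewrite /height -/N; lia.
Qed.

(** * The acyclic matching that removes the pairs with more than one vertex in s *)

Section Pivot.
Variable i0 : I.

Definition large p : bool := (1 < #|p.1|)%N.

Definition pivotal S v : bool := [exists p in S, large p && (v \in p.1)].

(** The [pick] supplies the minimization with a pivotal starting vertex; [i0] stands in when no pair
    is large. *)
Definition pivot S : I :=
  [arg min_(v < odflt i0 [pick v | pivotal S v] | pivotal S v) height S v].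

(** For eliminated S the choice of large pair is immaterial: the pivot has least rank in each one
    that contains it, so by [top_added] they all add the same vertex. *)
Definition toggle S : P :=
  let v := pivot S in
  ([set v], v |: added (odflt ([set v], [set v])
     [pick p in S | large p && (v \in p.1)])).

(** Lexicographic: the sum of the ranks first, then the height of the pivot in reverse, as heights
    are below N.+1 * N.+1. *)
Definition elim_key S : nat :=
  ((\sum_v rank S v) * (N.+1 * N.+1) + ((N.+1 * N.+1).-1 - height S (pivot S)))%N.

Lemma pivotP S p : p \in S -> large p ->
  pivotal S (pivot S) /\
  forall q v, q \in S -> large q -> v \in q.1 -> (height S (pivot S) <= height S v)%N.
Proof.
move=> pS pl; rewrite /pivot; case: arg_minnP => [|v vS vmin].
  case: pickP => // /(_ _) none; have /card_gt0P[v vp] : (0 < #|p.1|)%N.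
    by apply: ltn_trans pl.
  by have := none v; rewrite /pivotal; case/exists_inP; exists p => //; rewrite pl.
split=> // q w qS ql wq; apply: vmin; apply/exists_inP; exists q => //.
by rewrite ql.
Qed.

Lemma pivot_min S p : p \in S -> large p -> pivot S \in p.1 ->
  {in p.1, forall w, (rank S (pivot S) <= rank S w)%N}.
Proof.
move=> pS pl vp w wp; apply: height_rank; have [_] := pivotP pS pl.
by apply; [exact: pS| |].
Qed.

Lemma toggleP S : (exists2 p, p \in S & large p) ->
  exists p, [/\ p \in S, large p, pivot S \in p.1
              & toggle S = ([set pivot S], pivot S |: added p)].
Proof.
case=> q qS ql; have [/exists_inP[p pS /andP[pl pv]] _] := pivotP qS ql.
rewrite /toggle; case: pickP => [r /and3P[rS rl rv]|/(_ p)]; first by exists r.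
by rewrite pS pl pv.
Qed.

Lemma toggle_layer S : eliminated S -> (exists2 p, p \in S & large p) ->
  (forall k, layer (toggle S |: S) k = layer S k) /\
  (forall k, layer (S :\ toggle S) k = layer S k).
Proof.
move=> S0 lS; have [p [pS pl vp ex]] := toggleP lS.
have vk k : pivot S \in layer S k -> p.1 \subset layer S k.
  rewrite !mem_layer // => kr; apply/subsetP => w wp; rewrite mem_layer //.
  exact: leq_trans kr (pivot_min pS pl vp wp).
split; first by rewrite ex; apply: layer_add (vk) => //; left.
have [xS k|xS k] := boolP (toggle S \in S); last first.
  suff -> : S :\ toggle S = S by [].
  by apply/setP => z; rewrite !inE; case: eqP => // ->; rewrite (negPf xS).
(* Deleting the toggle is undone by adding it, so [layer_add] applies to the smaller set, with its
   hypothesis checked on S. *)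
have eS : S = ([set pivot S], pivot S |: added p) |: (S :\ toggle S).
  by rewrite -ex setD1K.
rewrite [in RHS]eS; apply/esym; apply: (layer_add (T := S)) => //.
  rewrite !inE pS andbT ex; apply: contraTneq pl => ->.
  by rewrite /large cards1.
by right.
Qed.

Lemma layer_rank S T : layer S =1 layer T -> rank S =1 rank T.
Proof. by move=> e v; apply: eq_bigr => k _; rewrite e. Qed.

Lemma pivot_eq S T : rank S =1 rank T ->
    (forall v, pivotal S v = pivotal T v) -> pivot S = pivot T.
Proof.
move=> er eP.
have eh v : height S v = height T v by rewrite /height er.
rewrite /pivot /arg_min /extremum (eq_pick (Q := pivotal T)) //.
congr odflt; apply: eq_pick => v /=; rewrite eP; congr (_ && _).
by apply: eq_forallb => w; rewrite eP !eh.
Qed.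

Definition well_formed p : bool :=
  [&& p.1 != set0, p.1 \subset p.2 & #|added p| == 1%N].

Definition elim_complex : {set {set P}} :=
  [set S | [&& S != set0, [forall p in S, well_formed p] & eliminated S]].

Definition star_complex : {set {set P}} :=
  [set S in elim_complex | [forall p in S, ~~ large p]].

Lemma elim_complex_is_complex : is_complex elim_complex.
Proof.
split=> [|S T]; first by rewrite inE eqxx.
rewrite !inE => /and3P[_ /forall_inP Sw S0] TS -> /=.
rewrite (eliminated_sub TS S0) andbT; apply/forall_inP => p pT.
by apply: Sw; apply: (subsetP TS).
Qed.

Lemma star_complex_is_complex : is_complex star_complex.
Proof.
have [K0 Kd] := elim_complex_is_complex; split=> [|S T].
  by rewrite inE (negPf K0).
rewrite inE => /andP[SK /forall_inP Sl] TS T0; rewrite inE (Kd S T) //=.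
by apply/forall_inP => p pT; apply: Sl; apply: (subsetP TS).
Qed.

Lemma star_complex_sub : star_complex \subset elim_complex.
Proof. by apply/subsetP => S; rewrite inE => /andP[]. Qed.

Lemma not_star S : S \in elim_complex :\: star_complex ->
  [/\ eliminated S, {in S, forall p, well_formed p} & exists2 p, p \in S & large p].
Proof.
rewrite in_setD => /andP[SX SE]; move: (SE); rewrite inE.
move=> /and3P[_ /forall_inP Sw S0]; split=> //; apply/exists_inP.
by move: SX; rewrite inE SE /= -negb_exists_in negbK.
Qed.

Lemma toggle_not_large S : (exists2 p, p \in S & large p) -> ~~ large (toggle S).
Proof. by move=> /toggleP[p [_ _ _ ->]]; rewrite /large cards1. Qed.

(** The layers do not change, and the toggled pair is not large; hence ranks, pivotal vertices,
    pivot and key all survive. *)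
Lemma toggle_step S T : S \in elim_complex :\: star_complex ->
    T = toggle S |: S \/ T = S :\ toggle S ->
  T \in elim_complex :\: star_complex /\ elim_key T = elim_key S.
Proof.
move=> SK TS; have [S0 Sw lS] := not_star SK.
have xl := toggle_not_large lS.
have eT : layer T =1 layer S.
  by have [e1 e2] := toggle_layer S0 lS; case: TS => ->.
have memT p : large p -> (p \in T) = (p \in S).
  by move=> pl; case: TS => ->; rewrite !inE; case: eqP => // ep;
     rewrite -ep pl in xl.
have [p [pS pl vp ex]] := toggleP lS.
have vNp : pivot S \notin added p by rewrite inE vp.
have xw : well_formed (toggle S).
  have /and3P[_ _ ap] := Sw p pS; rewrite /well_formed ex /=.
  rewrite sub1set setU11 -card_gt0 cards1 /=.
  suff -> : added ([set pivot S], pivot S |: added p) = added p by [].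
  by rewrite /added [_.1]/= [_.2]/= setU1K.
have TE : T \in elim_complex.
  rewrite inE /eliminated eT -/(eliminated S) S0 andbT; apply/andP; split.
    by apply/set0Pn; exists p; rewrite memT.
  apply/forall_inP => q; case: TS => ->; rewrite !inE.
    by case/predU1P => [->//|]; apply: Sw.
  by case/andP => _; apply: Sw.
split.
  rewrite in_setD TE andbT inE TE /= -negb_exists_in negbK.
  by apply/exists_inP; exists p; rewrite ?memT.
have er := layer_rank eT.
have ep : pivot T = pivot S.
  apply: pivot_eq er _ => v; apply/exists_inP/exists_inP => -[q qT ql].
    by exists q => //; rewrite -memT //; case/andP: ql.
  by exists q => //; rewrite memT //; case/andP: ql.
rewrite /elim_key ep /height er; congr (_ * _ + _)%N.
by apply: eq_bigr => v _; rewrite er.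
Qed.

(** Ranks grow with S. If their sum does not, all ranks agree, and the larger set, having more large
    pairs, has a pivot at most as high. Equal keys thus force equal pivots, and [top_added] in T
    gives equal toggles. *)
Lemma elim_key_mono S T : S \in elim_complex :\: star_complex ->
    T \in elim_complex :\: star_complex -> S \subset T ->
  (elim_key S <= elim_key T)%N /\ (elim_key S = elim_key T -> toggle S = toggle T).
Proof.
move=> SK TK ST; have [S0 _ lS] := not_star SK; have [T0 _ lT] := not_star TK.
have ler v := rank_mono v ST.
have lesum : (\sum_v rank S v <= \sum_v rank T v)%N by apply: leq_sum.
have [p [pS pl vp ->]] := toggleP lS; have [q [qT ql vq ->]] := toggleP lT.
have pT : p \in T := subsetP ST p pS.
have leh : \sum_v rank S v = \sum_v rank T v ->
    rank S =1 rank T /\ (height T (pivot T) <= height S (pivot S))%N.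
  move=> e; have er : rank S =1 rank T.
    move=> v; apply/eqP; rewrite eqn_leq ler leqNgt /=; apply/negP => lt.
    have: (\sum_v rank S v < \sum_v rank T v)%N; last by rewrite e ltnn.
    by rewrite (bigD1 v) //= [X in (_ < X)%N](bigD1 v) //= -addSn leq_add ?leq_sum.
  split=> //; have [_ /(_ p (pivot S) pT pl vp)] := pivotP pT pl.
  by rewrite /height er.
have hS := height_lt S (pivot S); have hT := height_lt T (pivot T).
rewrite /elim_key; have [e|ne] := eqVneq (\sum_v rank S v) (\sum_v rank T v).
  have [er le] := leh e; rewrite e; split; first by lia.
  move=> eh; have hh : height S (pivot S) = height S (pivot T).
    by rewrite [RHS]/height er -/(height T _); lia.
  have ev := height_inj hh; rewrite ev; congr (_, _ |: _).
  apply: (top_added T0 pT qT (v := pivot T)) => //; rewrite -?ev //.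
    by move=> w wp; rewrite -!er; apply: pivot_min pS pl vp w wp.
  by rewrite ev; apply: pivot_min.
have lt : (\sum_v rank S v < \sum_v rank T v)%N by rewrite ltn_neqAle ne.
split; [|move=> e; exfalso]; move: lt hS hT; first nia.
by move: e; nia.
Qed.

Lemma elim_complex_collapses : collapses elim_complex star_complex.
Proof.
apply: (collapses_toggle (key := elim_key) (x := toggle)).
- by case: elim_complex_is_complex.
- exact: star_complex_is_complex.
- exact: star_complex_sub.
- by move=> S T SK TK; apply: elim_key_mono.
move=> S SK; have [a b] := toggle_step SK (or_introl erefl).
by have [c d] := toggle_step SK (or_intror erefl).
Qed.

End Pivot.
End Elimination.

(** * Strong Morse matchings on the simplex *)

Section EliminationCriteria.
Variable I : finType.
Implicit Types (S : {set {set I} * {set I}}) (p : {set I} * {set I}).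

(** Each round then removes at least one remaining vertex, so #|I| rounds suffice. *)
Lemma eliminated_of_removable S :
  (forall W : {set I}, W != set0 -> removable S W != set0) -> eliminated S.
Proof.
move=> H; have bound k : (#|layer S k| <= #|I| - k)%N.
  elim: k => [|k IHk]; first by rewrite subn0 max_card.
  have [e|ne] := eqVneq (layer S k) set0.
    by rewrite /= e set0D cards0.
  have /card_gt0P[v vr] : (0 < #|removable S (layer S k)|)%N.
    by rewrite card_gt0 H.
  have /removableP[vW _] := vr.
  rewrite subnS -ltnS prednK; last by rewrite (leq_trans _ IHk) // card_gt0.
  apply: leq_trans IHk; apply: proper_card; apply/properP; split.
    exact: subsetDl.
  by exists v; rewrite //= in_setD vr.
by have := bound #|I|; rewrite subnn leqn0 cards_eq0.
Qed.

Lemma well_formedP p : well_formed p ->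
  exists a, [/\ a \notin p.1, p.2 = a |: p.1 & added p = [set a]].
Proof.
case/and3P => _ sub /cards1P[a ea]; exists a.
have : a \in added p by rewrite ea set11.
rewrite inE => /andP[ap _]; split=> //.
rewrite -ea /added; apply/setP => w; rewrite !inE.
by case: (boolP (w \in p.1)) => /= [/(subsetP sub)|]; rewrite ?orbT ?orbF.
Qed.

Lemma well_formed_add (s : {set I}) a : s != set0 -> a \notin s ->
  well_formed (s, a |: s) /\ added (s, a |: s) = [set a].
Proof.
move=> s0 as_; have e : added (s, a |: s) = [set a].
  apply/setP => w; rewrite !inE /=; case: eqP => [->|_] /=; first by rewrite as_.
  by rewrite andNb.
by rewrite /well_formed e cards1 s0 subsetUr.
Qed.

End EliminationCriteria.

Section MorseMatchings.
Variables (R : realType) (I : finType).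
Implicit Types (g : I -> R) (v w a : I).
Local Open Scope ring_scope.

Lemma mem_sublevel_full g v (s : {set I}) :
  (s \in sublevel (full_simplex I) g v) = (s != set0) && [forall w in s, g w <= g v].
Proof. by rewrite !inE. Qed.

Lemma mem_link (K : {set {set I}}) v s :
  (s \in link v K) = [&& s \in K, v \notin s & v |: s \in K].
Proof. by rewrite in_set. Qed.

Lemma descending_dominated_full g v a :
  descending_dominated_by (full_simplex I) g v a <-> a != v /\ g a <= g v.
Proof.
rewrite /descending_dominated_by.
move: (sublevel _ _ _) (mem_sublevel_full g v) => L memL.
split=> [[av [K0 [_ _ e]]]|[av gav]]; split=> //.
  have : [set a] \in link v L by rewrite e /cone setU11.
  rewrite mem_link !memL => /and3P[/andP[_ /forall_inP H] _ _].
  by apply: H; rewrite set11.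
have lev (s : {set I}) : s != set0 -> reflect {in s, forall w, g w <= g v} (s \in L).
  by move=> s0; rewrite memL s0; apply: forall_inP.
have L0 s : s \in L -> s != set0 by rewrite memL => /andP[].
have Lsub (s t : {set I}) : s \in L -> t \subset s -> t != set0 -> t \in L.
  move=> sL ts t0; apply/(lev _ t0) => w wt.
  by have /(lev _ (L0 s sL)) := sL; apply; apply: (subsetP ts).
have Lset (x : I) (s : {set I}) : x \in s -> {in s, forall w, g w <= g v} -> s \in L.
  by move=> xs H; apply/lev => //; apply/set0Pn; exists x.
(* The sublevel complex is a full simplex, so the cone is over its face opposite to v and a. *)
exists [set s in L | (v \notin s) && (a \notin s)]; split.
- split; first split.
  + by rewrite inE memL eqxx.
  + move=> s t; rewrite !inE => /and3P[sL vs as_] ts t0.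
    rewrite (Lsub s t) //=; apply/andP.
    by split; [apply: contra vs|apply: contra as_]; apply: (subsetP ts).
  + by apply/subsetP => s; rewrite inE => /andP[].
- by rewrite !inE eqxx !andbF.
apply/setP => s; rewrite mem_link; apply/and3P/idP => [[sL vs _]|].
  have [ea|sa] := eqVneq s [set a]; first by rewrite ea /cone setU11.
  rewrite !inE (negPf sa) sL vs /=.
  have [as_|//] := boolP (a \in s).
  apply/imsetP; exists (s :\ a); last by rewrite setD1K.
  rewrite !inE eqxx (negPf vs) andbF /= andbT; apply: Lsub sL _ _.
    exact: subD1set.
  apply: contra sa => /eqP e; rewrite eqEsubset sub1set as_ andbT.
  apply/subsetP => w ws; rewrite inE; apply: contraT => wa.
  by have := in_set0 w; rewrite -e !inE wa ws.
have main (s' : {set I}) : s' \in L -> v \notin s' -> [/\ s' \in L, v \notin s' & v |: s' \in L].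
  move=> sL vs; split=> //; apply: (Lset v); first exact: setU11.
  by move=> w /setU1P[->//|]; apply/(lev _ (L0 _ sL)).
rewrite /cone in_setU1 in_setU => /or3P[/eqP ->|sK|/imsetP[s' sK ->]].
- apply: main; last by rewrite inE eq_sym.
  by apply: (Lset a) => [|w]; rewrite inE // => /eqP ->.
- by move: sK; rewrite inE => /and3P[sL vs _]; apply: main.
move: sK; rewrite inE => /and3P[sL vs _].
apply: main; last by rewrite !inE negb_or eq_sym av.
apply: (Lset a); first exact: setU11.
by move=> w /setU1P[->//|]; apply/(lev _ (L0 _ sL)).
Qed.

(** The vertex v of W with the largest g is removable: a pair inside W that contains v has top
    vertex v and adds [c v], and every pair inside W adds a vertex strictly below its own top. *)
Lemma matching_eliminated g c (S : {set {set I} * {set I}}) :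
    vertex_filtration (full_simplex I) g ->
    dominating_choice (full_simplex I) g c ->
    S \subset associated_matching (full_simplex I) g c ->
  eliminated S /\ {in S, forall p, well_formed p}.
Proof.
move=> ginj cdom SM.
have vert v : v \in vertices (full_simplex I).
  by rewrite !inE -card_gt0 cards1.
have inM p : p \in S -> exists v, [/\ v \in p.1, {in p.1, forall w, g w <= g v},
    g (c v) < g v, well_formed p & added p = [set c v]].
  move=> pS; have := subsetP SM p pS; rewrite inE => /asboolP[v [vd pl vp cp ep]].
  move: pl; rewrite mem_sublevel_full => /andP[p0 /forall_inP H].
  have /descending_dominated_full[cv gcv] := cdom v vd.
  have [wf ap] := well_formed_add p0 cp.
  exists v; split=> //; try by move: wf ap; rewrite -ep -surjective_pairing.
  by rewrite lt_neqAle gcv andbT; apply: contra cv => /eqP/ginj->.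
split=> [|p /inM[v []] //].
apply: eliminated_of_removable => W /set0Pn[v0 v0W].
have [v vW vmax] : exists2 v, v \in W & {in W, forall w, g w <= g v}.
  by case: (arg_maxP g v0W) => v vW vmax; exists v.
have top p : p \in S -> p.1 \subset W -> v \notin added p /\
    (v \in p.1 -> added p = [set c v]).
  move=> pS pW; have [u [up umax gcu _ ->]] := inM p pS; split.
    rewrite inE; apply: contraTneq gcu => <-; rewrite -leNgt.
    by apply: vmax; apply: (subsetP pW).
  move=> vp; suff -> : u = v by [].
  apply: ginj => //; apply/eqP; rewrite eq_le umax // vmax //.
  exact: (subsetP pW).
apply/set0Pn; exists v; apply/removableP; split=> // p pS pW.
have [vp H] := top p pS pW; split=> // q qS qW vp1 vq1.
by have [_ H'] := top q qS qW; rewrite H // H'.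
Qed.

Lemma eliminated_matching (S : {set {set I} * {set I}}) :
    eliminated S -> {in S, forall p, well_formed p} ->
  exists2 M, strong_morse_matching R (full_simplex I) M & S \subset M.
Proof.
(* The first vertex eliminated must be the top one, whence the sign. *)
move=> S0 Sw; pose g v : R := - (height S v)%:R.
have gle v w : (g v <= g w) = (height S w <= height S v)%N by rewrite lerN2 ler_nat.
have glt v w : (g v < g w) = (height S w < height S v)%N by rewrite ltrN2 ltr_nat.
pose topp v p := [&& p \in S, v \in p.1 & [forall w in p.1, height S v <= height S w]%N].
(* A vertex that is the top of some pair of S takes what this pair adds, which [top_added] makes
   unambiguous and [top_notin_added] places lower; any other vertex takes an arbitrary lower one if
   possible. *)
pose c v := if [pick p | topp v p] is Some p then odflt v [pick a in added p]
            else odflt v [pick a | g a < g v].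
have toprank v p : topp v p ->
    [/\ p \in S, v \in p.1 & {in p.1, forall w, rank S v <= rank S w}%N].
  case/and3P => pS vp /forall_inP H; split=> // w wp.
  exact/height_rank/H.
have ctop v p : topp v p -> added p = [set c v] /\ g (c v) < g v.
  move=> tp; have [pS vp vmin] := toprank v p tp.
  rewrite /c; case: pickP => [q tq|/(_ p)]; last by rewrite tp.
  have [qS vq vminq] := toprank v q tq.
  have [a [_ _ ea]] := well_formedP (Sw q qS).
  case: pickP => [b|/(_ a)]; rewrite ea inE ?eqxx // => /eqP -> /=.
  rewrite (top_added S0 pS qS vp vq vmin vminq) ea; split=> //.
  have : (rank S v < rank S a)%N.
    by apply: (top_notin_added S0 qS vq vminq); rewrite ea set11.
  by rewrite ltNge gle => lt; apply/negP => /height_rank; rewrite leqNgt lt.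
have cdom v a : a != v -> g a <= g v -> g (c v) < g v.
  move=> av gav; have [[p tp]|none] := pselect (exists p, topp v p).
    by have [_] := ctop v p tp.
  rewrite /c; case: pickP => [p tp|_]; first by case: none; exists p.
  case: pickP => // /(_ a); rewrite lt_neqAle gav andbT => /negbFE/eqP.
  by move=> /oppr_inj/eqP; rewrite eqr_nat => /eqP/height_inj e; rewrite e eqxx in av.
exists (associated_matching (full_simplex I) g c).
  exists g, c; split=> //.
    by move=> v w _ _ /oppr_inj/eqP; rewrite eqr_nat => /eqP/height_inj.
  move=> v [a /descending_dominated_full[av gav]].
  apply/descending_dominated_full; have lt := cdom v a av gav.
  by split; [apply: contraTneq lt => ->; rewrite ltxx|exact: ltW].
apply/subsetP => p pS; rewrite inE; apply/asboolP.
have [a [ap ep ea]] := well_formedP (Sw p pS).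
have /and3P[p0 _ _] := Sw p pS; have [v0 v0p] := set0Pn _ p0.
have [v tv] : exists v, topp v p.
  case: (arg_minnP (height S) v0p) => v vp vmin; exists v.
  by apply/and3P; split=> //; apply/forall_inP.
have [ac gc] := ctop v p tv.
have eca : c v = a by apply/set1P; rewrite -ea ac set11.
case/and3P: tv => _ vp /forall_inP vmin; exists v; split.
- exists a; apply/descending_dominated_full; rewrite -eca (ltW gc); split=> //.
  by apply: contraTneq gc => ->; rewrite ltxx.
- rewrite mem_sublevel_full p0; apply/forall_inP => w /vmin.
  by rewrite gle.
- by [].
- by rewrite eca.
- by rewrite eca.
Qed.

Lemma SM_full_simplex : SM R (full_simplex I) = elim_complex I.
Proof.
apply/setP => S; rewrite !inE; have [//|S0] := eqVneq S set0; rewrite /=.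
apply/asboolP/andP => [[M [g [c [ginj cdom ->]]] SM]|[/forall_inP Sw S0']].
  have [? ?] := matching_eliminated ginj cdom SM; split=> //.
  exact/forall_inP.
exact: eliminated_matching.
Qed.

End MorseMatchings.

(** * Directed forests *)

Lemma connect_last (T : finType) (e : rel T) x y :
  connect e x y -> x = y \/ exists2 a, connect e x a & e a y.
Proof.
case/connectP => p; case/lastP: p => [|p b] /=; first by left.
rewrite rcons_path last_rcons => /andP[ep eb] ->; right.
by exists (last x p) => //; apply/connectP; exists p.
Qed.

Section RootedForests.
Variable I : finType.
Implicit Types (E F : {set I * I}) (a b v w x y : I).

(** The increasing rank r expresses acyclicity in a form that supports induction along arcs. *)
Definition rooted_forest E : Prop :=
  (forall a b v, (a, v) \in E -> (b, v) \in E -> a = b) /\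
  exists r : I -> nat, forall a v, (a, v) \in E -> (r a < r v)%N.

Definition forests : {set {set I * I}} :=
  [set E | (E != set0) && `[< rooted_forest E >]].

Lemma forestsP E : reflect (E != set0 /\ rooted_forest E) (E \in forests).
Proof.
by rewrite inE; apply: (iffP andP) => -[E0 /asboolP fE]; split=> //; apply/asboolP.
Qed.

Lemma rooted_forest_sub E F : E \subset F -> rooted_forest F -> rooted_forest E.
Proof.
move=> /subsetP EF [din [r rF]]; split; last by exists r => a v /EF/rF.
by move=> a b v /EF aF /EF bF; apply: din aF bF.
Qed.

Lemma forests_is_complex : is_complex forests.
Proof.
split=> [|E F /forestsP[_ fE] FE F0]; first by rewrite inE eqxx.
by apply/forestsP; split=> //; apply: rooted_forest_sub fE.
Qed.

Definition arc E : rel I := fun a v => (a, v) \in E.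

Definition parentless E v : bool := [forall a, (a, v) \notin E].

Lemma connect_rank E (r : I -> nat) :
    (forall a v, (a, v) \in E -> (r a < r v)%N) ->
  forall a v, connect (arc E) a v -> (r a <= r v)%N.
Proof.
move=> rE a _ /connectP[p + ->]; elim: p a => //= b p IHp a /andP[ab /IHp].
by apply: leq_trans; apply/ltnW/rE.
Qed.

Lemma root_exists E v : rooted_forest E ->
  exists2 x, parentless E x & connect (arc E) x v.
Proof.
move=> [_ [r rE]]; have [m] := ubnP (r v); elim: m v => // m IHm v rv.
have [vE|/forallPn[a]] := boolP (parentless E v); first by exists v.
rewrite negbK => av; have [|x xE xa] := IHm a.
  by apply: leq_trans (rE _ _ av) _; rewrite -ltnS.
by exists x => //; apply: connect_trans xa (connect1 _).
Qed.

(** Parents are unique, so both paths can be traced back from v in step until a root is met. *)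
Lemma root_unique E x y v : rooted_forest E -> parentless E x ->
  parentless E y -> connect (arc E) x v -> connect (arc E) y v -> x = y.
Proof.
move=> [din [r rE]] xE yE; have [m] := ubnP (r v); elim: m v => // m IHm v rv.
case/connect_last => [xv|[a xa av]] /connect_last[yv|[b yb bv]].
- by rewrite xv yv.
- by move/forallP: xE => /(_ b); rewrite xv [_ \in _]bv.
- by move/forallP: yE => /(_ a); rewrite yv [_ \in _]av.
move: yb; rewrite -(din _ _ _ av bv); apply: IHm => //.
by apply: leq_trans (rE _ _ av) _; rewrite -ltnS.
Qed.

Definition root E v : I :=
  odflt v [pick x | parentless E x && connect (arc E) x v].

Lemma rootP E v : rooted_forest E ->
  parentless E (root E v) /\ connect (arc E) (root E v) v.
Proof.
move=> fE; rewrite /root; case: pickP => [x /andP[]//|none].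
by have [x xE xv] := root_exists v fE; have := none x; rewrite xE xv.
Qed.

Lemma root_eq E x v : rooted_forest E -> parentless E x ->
  connect (arc E) x v -> root E v = x.
Proof.
by move=> fE xE xv; have [rE rv] := rootP v fE; apply: root_unique xv.
Qed.

Lemma root_arc E a v : rooted_forest E -> (a, v) \in E -> root E a = root E v.
Proof.
move=> fE av; have [rE ra] := rootP a fE; apply/esym/root_eq => //.
exact: connect_trans ra (connect1 _).
Qed.

Lemma card_rooted_forest E : rooted_forest E -> #|E| = #|[set v | ~~ parentless E v]|.
Proof.
move=> [din _]; rewrite -(card_in_imset (f := snd) (D := [in E])).
  apply: eq_card => v; rewrite inE; apply/imsetP/forallPn => [[[a w] aw ->]|[a]].
    by exists a; rewrite negbK.
  by rewrite negbK => av; exists (a, v).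
by move=> [a v] [b w] aE bE /= e; move: aE; rewrite e => aE; congr (_, _); apply: din bE.
Qed.

Lemma card_forest_le E (v : I) : rooted_forest E -> (#|E| <= #|I|.-1)%N.
Proof.
move=> fE; have [rE _] := rootP v fE; rewrite card_rooted_forest //.
rewrite -(cardC1 (root E v)); apply/subset_leq_card/subsetP => w.
by rewrite !inE; apply: contraNneq => ->.
Qed.

Lemma star_rooted_forest v : rooted_forest [set (v, w) | w in ~: [set v]].
Proof.
have mem a w : ((a, w) \in [set (v, w) | w in ~: [set v]]) = (a == v) && (w != v).
  apply/imsetP/andP => [[u + [-> ->]]|[/eqP -> wv]]; first by rewrite !inE.
  by exists w; rewrite ?inE.
split=> [a b w|]; first by rewrite !mem => /andP[/eqP -> _] /andP[/eqP -> _].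
by exists (fun w => (w != v) : nat) => a w; rewrite mem => /andP[/eqP -> ->]; rewrite eqxx.
Qed.

Lemma card_star v : #|[set (v, w) | w in ~: [set v]]| = #|I|.-1.
Proof. by rewrite card_imset ?cardsC1 // => w w' []. Qed.

End RootedForests.

(** * Directed forests defined by unique paths, compared with rooted forests *)

Section DirectedForestsOfGraph.
Variables (T : finType) (G : digraph T).
Implicit Types (E : {set T * T}).

Lemma directed_path_rcons (H : digraph T) x a v p :
  directed_path H x a p -> (a, v) \in darc H -> directed_path H x v (rcons p v).
Proof.
move=> [Hp pa] av; split; last by rewrite last_rcons.
by rewrite rcons_path Hp pa.
Qed.

(** For an arc a -> v, uniqueness makes the path to v that of a extended by v. Hence a is read off
    from the path to v, and the path length is a rank. *)
Lemma directed_forest_rooted (H : digraph T) :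
  directed_forest H -> rooted_forest (darc H).
Proof.
case: (pickP (@predT T)) => [t0 _|noT _]; last first.
  by split=> [a|]; [|exists (fun=> 0)%N => a]; have := noT a.
case=> Pi [parP trees noarc]; have /and3P[/eqP covP trivP _] := parP.
have [rt rtP] : exists rt : {set T} -> T,
    forall A, A \in Pi -> directed_tree (induced H A) (rt A).
  have /choice[rt rtP] A : exists x, A \in Pi -> directed_tree (induced H A) x.
    have [/trees[x xP]|nA] := boolP (A \in Pi); first by exists x.
    by exists t0.
  by exists rt.
have [q qP] : exists q : {set T} * T -> seq T, forall A y, A \in Pi ->
    y \in A -> y \in dvert H -> directed_path (induced H A) (rt A) y (q (A, y)) /\
    forall p, directed_path (induced H A) (rt A) y p -> q (A, y) = p.
  have /choice[q qP] (Ay : {set T} * T) : exists p, Ay.1 \in Pi -> Ay.2 \in Ay.1 ->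
      Ay.2 \in dvert H -> directed_path (induced H Ay.1) (rt Ay.1) Ay.2 p /\
      forall p', directed_path (induced H Ay.1) (rt Ay.1) Ay.2 p' -> p = p'.
    have [|no] := pselect [/\ Ay.1 \in Pi, Ay.2 \in Ay.1 & Ay.2 \in dvert H].
      case=> AP yA yH; have [_ /(_ Ay.2)] := rtP _ AP.
      by rewrite inE yA yH => /(_ isT)[p pP]; exists p.
    by exists [::] => *; case: no.
  by exists q => A y; apply: (qP (A, y)).
pose blk := pblock Pi; pose path_to v := q (blk v, v).
have main a v : (a, v) \in darc H -> blk a = blk v /\
    path_to v = rcons (path_to a) v /\ last (rt (blk v)) (path_to a) = a.
  move=> av; have /andP[aH vH] := darcP av; rewrite /= in aH vH.
  have aA : a \in blk a by rewrite mem_pblock covP.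
  have vA : v \in blk v by rewrite mem_pblock covP.
  have aP : blk a \in Pi by rewrite pblock_mem ?covP.
  have vP : blk v \in Pi by rewrite pblock_mem ?covP.
  have e : blk a = blk v.
    apply/eqP; apply: contraT => ne.
    by have := noarc _ _ aP vP ne _ _ aA vA; rewrite av.
  have [pa _] := qP _ _ aP aA aH; have [_ uniq_v] := qP _ _ vP vA vH.
  split=> //; rewrite /path_to e; rewrite e in pa aA; split; last by case: pa.
  apply: uniq_v; apply: directed_path_rcons pa _.
  by rewrite inE av /= aA vA.
split=> [a b v /main[_ [pa la]] /main[_ [pb lb]]|].
  by move: pb; rewrite pa => /rcons_inj[e]; rewrite -la e lb.
exists (size \o path_to) => a v /main[_ [pa _]] /=.
by rewrite pa size_rcons.
Qed.

Section Converse.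
Variable E : {set T * T}.
Hypothesis fE : rooted_forest E.

Fact arcs_in_setT e : e \in E -> (e.1 \in [set: T]) && (e.2 \in [set: T]).
Proof. by rewrite !inE. Qed.

Definition forest_digraph : digraph T := Digraph arcs_in_setT.

(** The trees are the fibres of [root]; isolated vertices form trees of their own. *)
Lemma rooted_forest_directed : directed_forest forest_digraph.
Proof.
exists (preim_partition (root E) setT); split.
- exact: preim_partitionP.
- move=> A /imsetP[v0 _ ->]; have [xE _] := rootP v0 fE.
  set x := root E v0 in xE *; set A' := [set y in _ | _].
  have memA y : (y \in A') = (root E y == x) by rewrite !inE eq_sym.
  have xx : root E x = x by apply: root_eq => //; apply: connect0.
  exists x; split; first by rewrite in_setI in_setT memA xx eqxx.
  have [din [r rE]] := fE.
  move=> y; rewrite in_setI memA => /andP[_ /eqP].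
  have [m] := ubnP (r y); elim: m y => // m IHm y ry yx.
  (* The last arc of a path to y must come from the unique parent a of y, so uniqueness passes from
     a to y. *)
  have uniq p' a : (a, y) \in E -> directed_path (induced forest_digraph A') x y p' ->
      exists2 p, p' = rcons p y & directed_path (induced forest_digraph A') x a p.
    move=> ay []; case/lastP: p' => [|p z] /=.
      by move=> _ exy; move/forallP: xE => /(_ a); rewrite exy ay.
    rewrite rcons_path last_rcons => /andP[pp lz] ez; move: lz; rewrite ez => lz.
    by exists p => //; split=> //; apply: din ay; move: lz; rewrite inE => /andP[].
  have [yE|/forallPn[a]] := boolP (parentless E y).
    have exy : y = x by rewrite -yx; apply/esym/root_eq => //; apply: connect0.
    exists [::]; split; first by rewrite exy.
    case/lastP => [//|p z] []; rewrite rcons_path last_rcons => /andP[_ lz] ez.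
    by move: lz; rewrite inE ez => /andP[+ _]; move/forallP: yE => /(_ (last x p))/negP.
  rewrite negbK => ay; have ax : root E a = x by rewrite (root_arc fE ay).
  have [|p [pP pu]] := IHm a _ ax; first by apply: leq_trans (rE _ _ ay) _; rewrite -ltnS.
  exists (rcons p y); split.
    apply: directed_path_rcons pP _.
    by rewrite inE [_ \in darc _]ay !memA ax yx eqxx.
  by move=> p' /(uniq _ _ ay)[p'' -> /pu ->].
move=> A B /imsetP[u _ ->] /imsetP[w _ ->] ne x y; rewrite !inE /= => /eqP ex /eqP ey.
apply: contra ne => /(root_arc fE) e; rewrite ex ey e; apply/eqP.
by apply/setP => z; rewrite !inE.
Qed.

End Converse.

Lemma mem_forest_complex : dvert G = setT ->
  forall E, (E \in forest_complex G) = (E \in forests T) && (E \subset darc G).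
Proof.
move=> GT E; rewrite inE [in RHS]inE -andbA; congr (_ && _).
apply/asboolP/andP => [[H [[_ sHG] fH <-]]|[/asboolP fE EG]].
  by split=> //; apply/asboolP/directed_forest_rooted.
exists (forest_digraph E); split=> //; last exact: rooted_forest_directed.
by split=> //; rewrite GT subsetT.
Qed.

End DirectedForestsOfGraph.

Lemma forest_complex_complete n : forest_complex (complete_digraph n) = forests 'I_n.
Proof.
apply/setP => E; rewrite mem_forest_complex //.
have [/forestsP[_ [_ [r rE]]]|//] := boolP (E \in forests _).
apply/subsetP => -[a v] /rE; rewrite inE /=.
by apply: contraTneq => ->; rewrite ltnn.
Qed.

(** * Toggling the arcs out of a vertex *)

Lemma isomorphic_image_complex (V W : finType) (f : V -> W) (v0 : V) K :
  injective f -> isomorphic (image_complex f K) K.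
Proof.
move=> f_inj; pose h w := odflt v0 [pick v | f v == w].
have fK v : h (f v) = v.
  rewrite /h; case: pickP => [u /eqP/f_inj//|/(_ v)].
  by rewrite eqxx.
have vertE w : w \in vertices (image_complex f K) -> exists2 v, w = f v & v \in vertices K.
  rewrite inE => /imsetP[s sK e].
  have : w \in f @: s by rewrite -e set11.
  case/imsetP => v vs ew; exists v => //; rewrite inE.
  suff -> : [set v] = s by [].
  by apply: (imset_inj f_inj); rewrite imset_set1 -ew.
have Evert v : v \in vertices K -> f v \in vertices (image_complex f K).
  by rewrite !inE -imset_set1 mem_image_complex.
exists h; split.
- by move=> _ _ /vertE[v -> _] /vertE[w -> _]; rewrite !fK => ->.
- apply/setP => v; apply/imsetP/idP => [[_ /vertE[u -> uK] ->]|vK].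
    by rewrite fK.
  by exists (f v); rewrite ?fK //; apply: Evert.
move=> s /subsetP sv.
suff e : f @: (h @: s) = s by rewrite -[LHS](mem_image_complex f_inj) e.
apply/setP => w; apply/imsetP/idP => [[_ /imsetP[u us ->] ->]|ws].
  by have [v ev _] := vertE u (sv u us); move: us; rewrite ev fK.
have [v ev _] := vertE w (sv w ws).
by exists v => //; apply/imsetP; exists w => //; rewrite ev fK.
Qed.

(** * Star pairs as arcs of rooted forests *)

Section StarsAndForests.
Variable I : finType.
Implicit Types (E : {set I * I}) (a b v w : I).

Definition arc_pair (e : I * I) : {set I} * {set I} := ([set e.2], [set e.1; e.2]).

Lemma arc_pair_inj : injective arc_pair.
Proof.
move=> [a v] [b w] [/set1_inj <- /setP e]; congr (_, _).
have := e a; have := e b; rewrite !inE !eqxx /=.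
by case: eqP => // _ /eqP -> /esym/orP[]/eqP.
Qed.

Lemma arc_pair_well_formed a v : well_formed (arc_pair (a, v)) = (a != v).
Proof.
rewrite /well_formed -card_gt0 cards1 /= subsetUr /= /added /= /arc_pair /=.
have [->|av] := eqVneq a v; first by rewrite setUid setDv cards0.
by rewrite setUC setU1K ?cards1 // inE eq_sym.
Qed.

Lemma added_arc_pair a v : a != v -> added (arc_pair (a, v)) = [set a].
Proof. by move=> av; rewrite /added /= setUC setU1K // inE eq_sym. Qed.

Lemma star_complex_forests : star_complex I = image_complex arc_pair (forests I).
Proof.
apply/setP => S; rewrite inE; apply/andP/imsetP => [[+ /forall_inP Sl]|[E fE ->]].
  rewrite inE => /and3P[S0 /forall_inP Sw elim].
  have inS p : p \in S -> exists a v, a != v /\ p = arc_pair (a, v).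
    move=> pS; have [a [ap ep _]] := well_formedP (Sw p pS).
    have /and3P[p0 _ _] := Sw p pS.
    have /cards1P[v ev] : #|p.1| == 1%N.
      by rewrite eqn_leq card_gt0 p0 andbT leqNgt; apply: Sl.
    exists a, v; move: ap; rewrite ev inE => av; split=> //.
    by rewrite [p]surjective_pairing ep ev.
  pose E := [set e | arc_pair e \in S].
  have ES : S = arc_pair @: E.
    apply/setP => p; apply/idP/imsetP => [pS|[e + ->]]; last by rewrite inE.
    by have [a [v [_ ep]]] := inS p pS; exists (a, v); rewrite ?inE -?ep.
  have arcE a v : (a, v) \in E -> a != v.
    by rewrite inE => /Sw; rewrite arc_pair_well_formed.
  have topv v a : {in (arc_pair (a, v)).1, forall w, (rank S v <= rank S w)%N}.
    by move=> w; rewrite inE => /eqP ->.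
  exists E => //; apply/forestsP; split.
    by apply: contra S0 => /eqP E0; rewrite ES E0 imset0.
  split=> [a b v aE bE|].
    have := arcE _ _ aE; have := arcE _ _ bE; rewrite !inE in aE bE => bv av.
    have := top_added elim aE bE (set11 v) (set11 v) (@topv v a) (@topv v b).
    by rewrite !added_arc_pair // => /set1_inj.
  (* Elimination removes heads of arcs before their tails, so its rank is reversed. *)
  exists (fun v => #|I| - rank S v)%N => a v aE.
  have av := arcE _ _ aE; rewrite inE in aE.
  have := top_notin_added elim aE (set11 v) (@topv v a) (w := a).
  rewrite added_arc_pair // set11 => /(_ isT) lt.
  by have := rank_le S a; lia.
have /forestsP[E0 [din [r rE]]] := fE.
have av a v : (a, v) \in E -> a != v.
  by move=> /rE; apply: contraTneq => ->; rewrite ltnn.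
split; last by apply/forall_inP => _ /imsetP[e _ ->]; rewrite /large cards1.
rewrite inE; apply/and3P; split.
- by apply: contra E0; rewrite imset_eq0.
- by apply/forall_inP => _ /imsetP[[a v] /av + ->]; rewrite arc_pair_well_formed.
apply: eliminated_of_removable => W /set0Pn[v0 v0W].
(* A deepest vertex of W is the tail of no arc whose head lies in W. *)
case: (arg_maxnP r v0W) => v vW vmax; apply/set0Pn; exists v.
apply/removableP; split=> // _ /imsetP[[a u] auE ->].
rewrite sub1set /= => uW; rewrite added_arc_pair ?av //; split.
  rewrite inE; apply: contraTneq (rE _ _ auE) => <-.
  by rewrite -leqNgt; apply: vmax.
move=> _ /imsetP[[b w] bwE ->] _; move=> /set1P /= eu /set1P /= ew.
move: auE bwE; rewrite -eu -ew => auE bwE.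
by rewrite added_arc_pair ?av // (din _ _ _ auE bwE).
Qed.

End StarsAndForests.

(* Since z can be made the parent of every other parentless vertex that is not *)
(* the root of z, toggling the arcs (z, v) pairs off all forests but the       *)
(* spanning trees in which z is a childless non-root.                          *)
Section CriticalForests.
Variable I : finType.
Variable z : I.
Implicit Types (E F : {set I * I}) (a b v w : I).

Definition avail E v : bool := (v != z) && `[< rooted_forest ((z, v) |: E) >].

Definition critical : {set {set I * I}} :=
  [set E in forests I | [forall v, ~~ avail E v]].

(** The new arc (z, v) must neither give v a second parent nor close a cycle. *)
Lemma availP E v : rooted_forest E ->
  reflect ((forall a, (a, v) \in E -> a = z) /\ ~~ connect (arc E) v z) (avail E v).
Proof.
move=> fE; apply: (iffP andP); have [din [r rE]] := fE.
  move=> [vz /asboolP[din' [r' rE']]]; split.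
    by move=> a av; apply: (din' a z v); rewrite !inE ?eqxx // av orbT.
  apply/negP => vz'; have : (r' v <= r' z)%N.
    apply: (connect_rank (E := E)) vz' => a w aw; apply: rE'.
    by rewrite !inE aw orbT.
  by rewrite leqNgt rE' // !inE eqxx.
move=> [pz vNz]; split; first by apply: contraNneq vNz => ->; apply: connect0.
apply/asboolP; split=> [a b w|].
  rewrite !inE !xpair_eqE => /orP[/andP[/eqP -> /eqP ->]|aw].
    by case/orP => [/andP[/eqP -> _]|/pz].
  case/orP => [/andP[/eqP -> /eqP ew]|bw]; last exact: din bw.
  by move: aw; rewrite ew => /pz.
(* Vertices that are not ancestors of z are lifted above z, so the new arc increases the rank as
   well. *)
exists (fun u => r u + (if connect (arc E) u z then 0 else (r z).+1))%N => a w.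
rewrite !inE xpair_eqE => /orP[/andP[/eqP -> /eqP ->]|aw].
  by rewrite connect0 (negPf vNz); lia.
have := rE a w aw; case: ifP => az; case: ifP => wz //; try lia.
by move: az; rewrite (connect_trans (connect1 aw) wz).
Qed.

Lemma avail_mono E F v : E \subset F -> avail F v -> avail E v.
Proof.
move=> EF /andP[vz /asboolP fF]; rewrite /avail vz; apply/asboolP.
by apply: rooted_forest_sub fF; apply: setUS.
Qed.

(** A path to z through the new arc would continue from v to z, which the availability of v
    excludes; so z gains no ancestors. *)
Lemma avail_add E v w : rooted_forest E -> avail E v -> avail E w ->
  avail ((z, v) |: E) w.
Proof.
move=> fE av aw; have /andP[_ /asboolP fEv] := av.
have /(availP _ fE)[wp wNz] := aw; have /(availP _ fE)[vp vNz] := av.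
apply/(availP _ fEv); split=> [a|].
  by rewrite !inE xpair_eqE => /orP[/andP[/eqP -> _]//|/wp].
suff H u : connect (arc ((z, v) |: E)) u z -> connect (arc E) u z.
  by apply: contra wNz; apply: H.
have [_ [r rE]] := fEv.
case/connectP => p + ez; elim: p u ez => [u -> _|u' p IHp u /= ez /andP[uu' pp]].
  exact: connect0.
have := IHp _ ez pp; move: uu'; rewrite /arc !inE xpair_eqE.
case/orP => [/andP[_ /eqP -> vz]|uu']; first by rewrite vz in vNz.
by apply: connect_trans; apply: connect1.
Qed.

Variable v1 : I.
Hypothesis v1z : v1 != z.

Definition first_avail E : I :=
  [arg min_(v < odflt v1 [pick v | avail E v] | avail E v) enum_rank v].

Definition first_other : I := [arg min_(v < v1 | v != z) enum_rank v].

Lemma first_availP E v : avail E v -> avail E (first_avail E) /\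
  forall w, avail E w -> (enum_rank (first_avail E) <= enum_rank w)%N.
Proof.
move=> Ev; rewrite /first_avail; case: arg_minnP => [|u Eu umin]; last by [].
by case: pickP => // /(_ v); rewrite Ev.
Qed.

Lemma first_otherP : first_other != z /\
  forall w, w != z -> (enum_rank first_other <= enum_rank w)%N.
Proof. by rewrite /first_other; case: arg_minnP. Qed.

(** The face left unpaired: deleting its toggled arc would give the empty face. *)
Definition base_face : {set {set I * I}} := [set [set (z, first_other)]].

Lemma noncriticalP E : E \in forests I :\: critical ->
  [/\ E != set0, rooted_forest E & exists v, avail E v].
Proof.
rewrite in_setD => /andP[]; rewrite inE => + fE; rewrite fE /=.
have /forestsP[E0 rE] := fE; rewrite negb_forall => /existsP[v].
by rewrite negbK => av; split=> //; exists v.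
Qed.

Lemma noncriticalI E v : E != set0 -> rooted_forest E -> avail E v ->
  E \in forests I :\: critical.
Proof.
move=> E0 fE av; have FE : E \in forests I by apply/forestsP.
rewrite in_setD FE andbT inE FE /= negb_forall; apply/existsP; exists v.
by rewrite negbK.
Qed.

Lemma noncritical_complex : is_complex (forests I :\: critical).
Proof.
have [F0 Fd] := forests_is_complex I; split=> [|E E' /noncriticalP[E0 fE [v av]] sE E'0].
  by rewrite in_setD (negPf F0) andbF.
by apply: (noncriticalI (v := v)) => //; [apply: rooted_forest_sub fE|apply: avail_mono av].
Qed.

Lemma avail_arc v : v != z -> rooted_forest [set (z, v)].
Proof.
by move=> vz; apply: rooted_forest_sub (star_rooted_forest z);
  apply/subsetP => e /set1P ->; apply/imsetP; exists v; rewrite ?inE.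
Qed.

Lemma avail_singleton v w : v != z -> w != z -> avail [set (z, v)] w.
Proof.
move=> vz wz; rewrite /avail wz; apply/asboolP.
apply: rooted_forest_sub (star_rooted_forest z); apply/subsetP => e.
by case/set2P => ->; apply/imsetP; [exists w|exists v]; rewrite ?inE.
Qed.

Lemma first_avail_singleton v : v != z -> first_avail [set (z, v)] = first_other.
Proof.
move=> vz; have [oz omin] := first_otherP.
have ao := avail_singleton vz oz; have [af fmin] := first_availP ao.
apply/enum_rank_inj/val_inj/eqP; rewrite eqn_leq fmin // omin //.
by case/andP: af.
Qed.

(** Adding or deleting an available arc out of z changes no availability, so the first available one
    can be toggled. A larger forest has fewer available arcs, so the position of the first is a
    monotone key. *)
Lemma noncritical_collapses : collapses (forests I :\: critical) base_face.
Proof.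
have [oz _] := first_otherP.
have [K0 _] := noncritical_complex.
apply: (collapses_toggle (key := fun E => enum_rank (first_avail E) : nat)
  (x := fun E => (z, first_avail E))) => //.
- split=> [|s t]; first by rewrite inE eq_sym -card_gt0 cards1.
  by rewrite inE => /eqP ->; rewrite subset1 inE => /orP[//|->].
- apply/subsetP => E /set1P ->; apply: (noncriticalI (v := first_other)).
  + by rewrite -card_gt0 cards1.
  + exact: avail_arc.
  + exact: avail_singleton.
- move=> E F; rewrite in_setD => /andP[_ EK]; rewrite in_setD => /andP[_ FK] EF.
  have [_ _ [v Ev]] := noncriticalP EK; have [_ _ [w Fw]] := noncriticalP FK.
  have [aE mE] := first_availP Ev; have [aF _] := first_availP Fw.
  split; first by apply: mE; apply: avail_mono aF.
  by move=> /val_inj/enum_rank_inj ->.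
move=> E; rewrite in_setD => /andP[EL EK]; rewrite inE in EL.
have [E0 fE [v0 Ev0]] := noncriticalP EK; have [aE mE] := first_availP Ev0.
set v := first_avail E in aE mE *; have vz : v != z by case/andP: aE.
have step F : rooted_forest F -> F != set0 -> (forall w, avail F w = avail E w) ->
    F != [set (z, first_other)] ->
    F \in (forests I :\: critical) :\: base_face /\ first_avail F = v.
  move=> fF F0 aF FL; rewrite in_setD inE FL /=; split.
    by apply: (noncriticalI (v := v)); rewrite ?aF.
  have Fv : avail F v by rewrite aF.
  have [a m] := first_availP Fv; apply/enum_rank_inj/val_inj/eqP.
  by rewrite eqn_leq m // mE // -aF.
have [||||a1 ->] := step ((z, v) |: E).
- by case/andP: aE => _ /asboolP.
- by apply/set0Pn; exists (z, v); rewrite setU11.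
- move=> w; apply/idP/idP; first by apply: avail_mono; apply: subsetUr.
  exact: avail_add.
- apply/negP => /eqP e; case/negP: EL; rewrite eqEcard cards1 card_gt0 E0 andbT.
  by rewrite -e subsetUr.
have fD : rooted_forest (E :\ (z, v)) by apply: rooted_forest_sub fE; apply: subD1set.
have aD w : avail (E :\ (z, v)) w = avail E w.
  apply/idP/idP; last by apply: avail_mono; apply: subD1set.
  have [vE aw|vE] := boolP ((z, v) \in E).
    rewrite -(setD1K vE); apply: avail_add => //.
    by apply: avail_mono aE; apply: subD1set.
  rewrite (_ : E :\ (z, v) = E) //; apply/setP => e; rewrite !inE.
  by case: eqP => // ->; rewrite (negPf vE).
have [||||a2 ->] := step (E :\ (z, v)) => //.
- apply: contra EL => /eqP e0.
  have Ev : E = [set (z, v)].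
    by apply/eqP; rewrite eqEcard cards1 card_gt0 E0 andbT -setD_eq0 e0.
  by rewrite Ev /v Ev first_avail_singleton.
- apply/negP => /eqP e.
  have [am mm] := first_availP (avail_singleton oz oz).
  have ev : v = first_other.
    have /(_ v) := aD; rewrite e.
    have ao : avail E first_other by rewrite -aD e avail_singleton.
    have [_ omin] := first_otherP.
    by move=> _; apply/enum_rank_inj/val_inj/eqP; rewrite eqn_leq mE // omin.
  by have := setD11 (z, v) E; rewrite e ev set11.
Qed.

End CriticalForests.

(** * Counting flows *)

Lemma sum_subset_card (I : finType) (S : {set I}) (G : nat -> nat) :
  \sum_(T : {set I} | T \subset S) G #|T| = \sum_(j < #|S|.+1) 'C(#|S|, j) * G j.
Proof.
rewrite (partition_big (fun T : {set I} => inord #|T| : 'I_#|S|.+1) xpredT) //=.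
apply: eq_bigr => j _.
rewrite [RHS](_ : _ = #|[set T : {set I} | T \subset S & #|T| == j]| * G j)%N;
  last by rewrite cards_draws.
rewrite -[in RHS]sum1_card big_distrl /=.
rewrite [RHS](eq_bigl (fun T : {set I} => (T \subset S) && (inord #|T| == j))).
  apply: eq_bigr => T /andP[TS /eqP <-].
  by rewrite mul1n inordK // ltnS subset_leq_card.
move=> T; rewrite inE; have [TS|//] := boolP (T \subset S).
by rewrite -(inj_eq val_inj) /= inordK // ltnS subset_leq_card.
Qed.

Section Flows.
Variables (I : finType) (i0 : I).
Implicit Types (S B T D : {set I}) (p q : {ffun I -> I}).

(** The fixed value [i0] outside S gives each map from S to D exactly one representative. *)
Definition maps S D : {set {ffun I -> I}} :=
  [set p : {ffun I -> I} | [forall v, if v \in S then p v \in D else p v == i0]].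

Lemma mapsP S D p :
  reflect (forall v, if v \in S then p v \in D else p v == i0) (p \in maps S D).
Proof. by rewrite inE; apply: forallP. Qed.

Lemma card_maps S D : #|maps S D| = (#|D| ^ #|S|)%N.
Proof.
rewrite -(card_pffun_on i0 (mem S) (mem D)); apply: eq_card => p.
apply/mapsP/pffun_onP => [H|[/subsetP sup im] v].
  split; first by apply/subsetP => v; rewrite inE; have := H v; case: ifP => // _ ->.
  by move=> _ /imageP[v vS ->]; have := H v; rewrite [v \in S]vS.
case: ifP => vS; first by apply: im; apply/imageP; exists v.
by apply: contraFT vS => pv; apply: sup.
Qed.

(** Parent functions of the forests on S and B with root set B: since r decreases, iterating p from
    S ends in B. *)
Definition flow S B : {set {ffun I -> I}} :=
  [set p in maps S (S :|: B) |
    `[< exists r : I -> nat, {in S, forall v, r (p v) < r v}%N >]].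

Lemma flowP S B p : reflect
  (p \in maps S (S :|: B) /\ exists r : I -> nat, {in S, forall v, r (p v) < r v}%N)
  (p \in flow S B).
Proof.
rewrite [X in reflect _ X]inE.
by apply: (iffP andP) => -[pM /asboolP fp]; split=> //; apply/asboolP.
Qed.

Definition restrict S p : {ffun I -> I} := [ffun v => if v \in S then p v else i0].

(** Once T is the set sent directly into B, the map from T to B is arbitrary, and the other vertices
    form a flow with target T. *)
Lemma card_flow_layer S B T : [disjoint S & B] -> T \subset S ->
  #|[set p in flow S B | [set v in S | p v \in B] == T]| =
  (#|B| ^ #|T| * #|flow (S :\: T) T|)%N.
Proof.
move=> dSB /subsetP TS; rewrite -card_maps -cardsX.
have SB v : v \in S -> v \notin B by move/(disjointFr dSB) ->.
pose split_at p := (restrict T p, restrict (S :\: T) p).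
rewrite -(card_in_imset (f := split_at)); last first.
  move=> p q; rewrite inE => /andP[/flowP[/mapsP pS _] _].
  rewrite inE => /andP[/flowP[/mapsP qS _] _] [/ffunP e1 /ffunP e2].
  apply/ffunP => v; have := e1 v; have := e2 v; rewrite !ffunE inE.
  have := pS v; have := qS v; case: (boolP (v \in S)) => vS /=.
    by case: (v \in T).
  by move=> /eqP -> /eqP ->.
apply: eq_card => -[q1 q2]; apply/imsetP/setXP => [[p + [-> ->]]|[q1M q2F]].
  rewrite inE => /andP[/flowP[/mapsP pS [r rp]] /eqP eT].
  have memT v : (v \in T) = (v \in S) && (p v \in B) by rewrite -eT inE.
  split; first by apply/mapsP => v; rewrite ffunE memT; case: andP => [[_ ->]|].
  apply/flowP; split; last first.
    by exists r => v vST; rewrite ffunE vST; apply: rp; move: vST; rewrite inE => /andP[].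
  apply/mapsP => v; rewrite ffunE; case: ifP => vST; rewrite ?vST //.
  move: vST; rewrite in_setD memT => /andP[+ vS]; rewrite vS /= => pB.
  have := pS v; rewrite vS !inE (negPf pB) orbF => pvS.
  by rewrite pvS andbT orNb.
have /flowP[/mapsP q2M [r rq]] := q2F; move/mapsP: q1M => q1M.
pose p : {ffun I -> I} := [ffun v => if v \in T then q1 v else q2 v].
have pT v : v \in T -> p v \in B by move=> vT; rewrite ffunE vT; have := q1M v; rewrite vT.
have pST v : v \in S -> v \notin T -> p v \in S.
  move=> vS vT; rewrite ffunE (negPf vT); have := q2M v; rewrite inE vT vS /=.
  by rewrite !inE => /orP[/andP[]//|/TS].
exists p; last first.
  congr (_, _); apply/ffunP => v; rewrite !ffunE.
    by case: ifP => // vT; have := q1M v; rewrite vT => /eqP.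
  have := q2M v; rewrite !inE.
  by case: (v \in T) => /=; [move/eqP|case: (v \in S) => // /eqP].
rewrite inE; apply/andP; split; last first.
  apply/eqP/setP => v; rewrite inE; apply/andP/idP => [[vS]|vT]; last by rewrite TS ?pT.
  by apply: contraTT => vT; apply: SB; apply: pST.
apply/flowP; split.
  apply/mapsP => v; case: ifP => vS; rewrite ?in_setU.
    by have [/pT ->|vT] := boolP (v \in T); rewrite ?orbT // pST.
  rewrite ffunE; have [/TS|vT] := boolP (v \in T); first by rewrite vS.
  by have := q2M v; rewrite inE vS andbF.
exists (fun v => if v \in B then 0 else (r v).+1)%N => v vS /=.
rewrite (negPf (SB v vS)); have [/pT ->|vT] := boolP (v \in T); first by [].
case: ifP => // _; rewrite ltnS ffunE (negPf vT); apply: rq.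
by rewrite inE vT.
Qed.

Lemma flow_no_target S : S != set0 -> flow S set0 = set0.
Proof.
move=> /set0Pn[v0 v0S]; apply/eqP; rewrite -subset0; apply/subsetP => p.
case/flowP=> /mapsP pS [r rp]; case: (arg_minnP r v0S) => v vS vmin.
have := pS v; rewrite setU0 [v \in S]vS => /vmin.
by rewrite leqNgt rp.
Qed.

Lemma flow_no_source B : #|flow set0 B| = 1%N.
Proof.
have -> : flow set0 B = maps set0 B; last by rewrite card_maps cards0.
apply/setP => p; apply/flowP/mapsP => [[/mapsP H _] v|H].
  by have := H v; rewrite inE.
split; first by apply/mapsP => v; have := H v; rewrite inE.
by exists (fun=> 0%N) => v; rewrite inE.
Qed.

(* Induction over the set T of vertices sent directly into B: the others flow  *)
(* to T, and the binomial formula evaluates the sum over T.                    *)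
Theorem card_flow S B : [disjoint S & B] -> S != set0 ->
  #|flow S B| = (#|B| * (#|B| + #|S|) ^ #|S|.-1)%N.
Proof.
have [m] := ubnP #|S|; elim: m S B => // m IHm S B Sm dSB S0.
(* The number of flows for which j given vertices are sent into B, by induction; the cases j = 0 and
   j = #|S| fall outside the induction hypothesis. *)
pose G j := (if j == 0 then 0 else if #|S| - j == 0 then #|B| ^ j
             else #|B| ^ j * (j * #|S| ^ (#|S| - j).-1))%N.
have -> : #|flow S B| = \sum_(T : {set I} | T \subset S) G #|T|.
  rewrite -sum1_card (partition_big (fun p : {ffun I -> I} => [set v in S | p v \in B])
    (fun T : {set I} => T \subset S)) /=; last first.
    by move=> p _; apply/subsetP => v; rewrite inE => /andP[].
  apply: eq_bigr => T TS; rewrite sum1dep_card card_flow_layer // /G.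
  have [/eqP|T0] := eqVneq #|T| 0.
    by rewrite cards_eq0 => /eqP ->; rewrite setD0 flow_no_target // !cards0 muln0.
  have cST : #|S :\: T| = (#|S| - #|T|)%N by rewrite cardsD (setIidPr TS).
  case: ifP => [/eqP e|/negbT ne].
    have -> : S :\: T = set0 by apply: cards0_eq; rewrite cST.
    by rewrite flow_no_source muln1.
  rewrite IHm.
  - have le := subset_leq_card TS; rewrite cST; congr (_ * (_ * _ ^ _))%N; lia.
  - have le := subset_leq_card TS; rewrite cST; lia.
  - by rewrite -setI_eq0 setIC setIDA setDIl setDv set0I.
  - by rewrite -card_gt0 cST lt0n.
rewrite sum_subset_card big_ord_recl /= muln0 add0n.
have [s es] : exists s, #|S| = s.+1 by exists #|S|.-1; rewrite prednK // card_gt0.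
rewrite /G es [in RHS]/= addnC expnDn big_distrr /=.
apply: eq_bigr => j _; rewrite /bump /= add1n subSS.
have lej : (j <= s)%N by rewrite -ltnS.
have [/eqP|ne] := eqVneq (s - j)%N 0%N.
  rewrite subn_eq0 => sj; have -> : (j : nat) = s by apply/eqP; rewrite eqn_leq lej.
  by rewrite !binn subnn !expn0 !mul1n expnS.
(* The absorption identity turns the factor j.+1 and the binomial over s.+1 into s.+1 times a
   binomial over s. *)
have diag := mul_bin_diag s.+1 j; rewrite /= in diag.
have -> : (s.+1 ^ (s - j) = s.+1 * s.+1 ^ (s - j).-1)%N.
  by rewrite -expnS prednK // lt0n.
rewrite expnS; move: (expn _ _) (expn _ _) diag => x y diag.
transitivity (#|B| * x * y * (j.+1 * 'C(s.+1, j.+1)))%N; first by lia.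
by rewrite -diag; lia.
Qed.

End Flows.

(** * Counting critical forests *)

Section CountCritical.
Variable I : finType.
Variables z v1 : I.
Hypothesis v1z : v1 != z.
Implicit Types (E : {set I * I}) (a r v w : I) (p : {ffun I -> I}).

(** A vertex v other than z with parent z is available because (z, v) is already there, and a
    parentless one is available unless it is the root of z. *)
Lemma critical_parent E v : E \in critical z -> v != root E z ->
  exists2 a, (a, v) \in E & v != z -> a != z.
Proof.
rewrite inE => /andP[/forestsP[_ fE] /forallP noav] vr.
have [rE rz] := rootP z fE.
have [vE|/forallPn[a]] := boolP (parentless E v); last first.
  rewrite negbK => av; exists a => // vz; apply/eqP => az; move: (noav v).
  rewrite /avail vz /=; case/negP; apply/asboolP.
  by rewrite -az (setUidPr _) // sub1set.
have [vz|vz] := eqVneq v z.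
  by case/eqP: vr; apply/esym/root_eq => //; rewrite vz connect0.
case/negP: (noav v); apply/(availP _ _ fE); split.
  by move=> a av; move/forallP: vE => /(_ a); rewrite av.
by apply: contra vr => vz'; apply/eqP/esym/root_eq.
Qed.

(** Otherwise a vertex of least rank other than z would have a parent other than z, of smaller rank
    still. *)
Lemma critical_root E : E \in critical z -> root E z != z.
Proof.
move=> Ec; apply/eqP => rz; have := Ec; rewrite inE => /andP[/forestsP[_ [_ [r rE]]] _].
case: (@arg_minnP _ v1 (fun v => v != z) r v1z) => v vz vmin.
have vr : v != root E z by rewrite rz.
have [a av /(_ vz)/vmin] := critical_parent Ec vr.
by rewrite leqNgt rE.
Qed.

Lemma card_critical_face E : E \in critical z -> #|E| = #|I|.-1.
Proof.
move=> Ec; have := Ec; rewrite inE => /andP[/forestsP[_ fE] _].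
have [rE _] := rootP z fE.
rewrite card_rooted_forest // -(cardC1 (root E z)); apply: eq_card => v.
rewrite !inE; apply/idP/idP => [|/(critical_parent Ec)[a av _]].
  by apply: contraNneq => ->.
by apply/forallPn; exists a; rewrite negbK.
Qed.

(** In (r, (a, p)), r is the root, a the parent of the leaf z, and p the parent function of the tree
    left after deleting z. *)
Definition code := (I * (I * {ffun I -> I}))%type.

Definition codes : {set code} :=
  [set t : code | [&& t.1 != z, t.2.1 != z
               & t.2.2 \in flow z (~: [set z; t.1]) [set t.1]]].

Lemma mem_codes r a p : ((r, (a, p)) \in codes) =
  [&& r != z, a != z & p \in flow z (~: [set z; r]) [set r]].
Proof. by rewrite in_set. Qed.

Definition decode (t : code) : {set I * I} :=
  (t.2.1, z) |: [set (t.2.2 v, v) | v in ~: [set z; t.1]].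

Lemma mem_decode r a p b v : r != z ->
  ((b, v) \in decode (r, (a, p))) =
  if v == z then b == a else (v != r) && (b == p v).
Proof.
move=> rz; rewrite in_setU1 xpair_eqE /=.
have -> : ((b, v) \in [set (p w, w) | w in ~: [set z; r]]) =
    [&& v != z, v != r & b == p v].
  apply/imsetP/and3P => [[w + [-> ->]]|[vz vr /eqP ->]].
    by rewrite !inE negb_or => /andP[].
  by exists v => //; rewrite !inE negb_or vz.
by case: (v =P z); rewrite ?andbT ?andbF ?orbF.
Qed.

(** With n = #|I|.-1, there are n choices of r, n of a, and n^(n-2) trees with root r on the
    vertices other than z. *)
Lemma card_codes : #|codes| = (#|I|.-1 ^ #|I|.-1)%N.
Proof.
have cI : (1 < #|I|)%N.
  by have := max_card (mem [set v1; z]); rewrite cards2 v1z.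
rewrite -sum1_card (partition_big fst (fun r : I => r != z)) /=; last first.
  by move=> t; rewrite inE => /andP[].
have inner r : r != z -> \sum_(t in codes | t.1 == r) 1 = (#|I|.-1 ^ #|I|.-2)%N.
  move=> rz; rewrite sum1dep_card.
  have -> : [set t : code | (t \in codes) && (t.1 == r)] =
      setX [set r] (setX [set~ z] (flow z (~: [set z; r]) [set r])).
    apply/setP => -[r' [a p]]; rewrite !inE /= andbC.
    by case: eqP => //= ->; rewrite rz.
  rewrite !cardsX cards1 mul1n cardsC1.
  have cS : #|~: [set z; r]| = #|I|.-2.
    by rewrite cardsCs setCK cards2 eq_sym rz; lia.
  (* With only two vertices the source is empty, a case that [card_flow] excludes. *)
  have [e0|ne] := eqVneq (~: [set z; r]) set0.
    rewrite e0 flow_no_source muln1; move: cS; rewrite e0 cards0.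
    by case: (#|I|) cI => [|[|[|k]]].
  have dis : [disjoint ~: [set z; r] & [set r]].
    by rewrite disjoint_sym disjoints1 !inE eqxx orbT.
  rewrite card_flow // cards1 mul1n cS add1n.
  move: ne; rewrite -card_gt0 cS; case: (#|I|) cI => [|[|[|k]]] //= _ _.
  by rewrite -expnS.
rewrite (eq_bigr _ inner) sum_nat_const -(cardC1 z).
have -> : #|[pred r | r != z]| = #|predC1 z| by apply: eq_card.
rewrite cardC1; case: (#|I|) cI => [|[|k]] //= _.
by rewrite -expnS.
Qed.

Lemma decode_inj : {in codes &, injective decode}.
Proof.
move=> [r [a p]] [r' [a' p']]; rewrite !mem_codes => /and3P[rz az pF] /and3P[rz' az' pF'] e.
have memE b v : ((b, v) \in decode (r, (a, p))) = ((b, v) \in decode (r', (a', p'))).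
  by rewrite e.
have er : r = r'.
  (* No arc of the first tree enters r, whereas (p' r, r) is an arc of the second unless r = r'. *)
  have := memE (p' r) r; rewrite !mem_decode // (negPf rz) !eqxx /= andbT.
  by move/esym/negbFE/eqP.
have ea : a = a'.
  by have := memE a z; rewrite !mem_decode // !eqxx => /esym/eqP.
rewrite -er in pF' *; rewrite ea; congr (_, (_, _)); apply/ffunP => v.
have /flowP[/mapsP/(_ v) pv _] := pF; have /flowP[/mapsP/(_ v) pv' _] := pF'.
move: pv pv'; case: ifP => [|_ /eqP -> /eqP -> //]; rewrite !inE negb_or => /andP[vz vr] _ _.
have := memE (p v) v; rewrite -er !mem_decode // (negPf vz) vr !eqxx /=.
by move/esym/eqP.
Qed.

Lemma critical_decode : critical z = decode @: codes.
Proof.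
apply/setP => E; apply/idP/imsetP => [Ec|[[r [a p]] + ->]]; last first.
  rewrite mem_codes => /and3P[rz az /flowP[/mapsP pS [rk rkp]]].
  have pz v : v != z -> v != r -> p v != z.
    move=> vz vr; have := pS v; rewrite !inE negb_or vz vr /=.
    by case/orP => [|/eqP ->]; rewrite ?negb_or => // /andP[].
  have memE := mem_decode a p _ _ rz.
  have fE : rooted_forest (decode (r, (a, p))).
    split=> [b c v|].
      by rewrite !memE; case: ifP => _ => [/eqP -> /eqP ->|/andP[_ /eqP ->] /andP[_ /eqP ->]].
    (* As a leaf, z may be ranked above all other vertices. *)
    exists (fun u => if u == z then (\max_w rk w).+1 else rk u) => b v.
    rewrite memE; case: (eqVneq v z) => [_ /eqP ->|vz /andP[vr /eqP ->]].
      by rewrite (negPf az) ltnS leq_bigmax.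
    by rewrite (negPf (pz _ vz vr)); apply: rkp; rewrite !inE negb_or vz.
  have rless : parentless (decode (r, (a, p))) r.
    by apply/forallP => b; rewrite memE (negPf rz) eqxx.
  have rootr : root (decode (r, (a, p))) z = r.
    have [rE _] := rootP z fE; set x := root _ _ in rE *.
    apply/eqP; apply: contraT => xr; move/forallP: rE.
    case: (eqVneq x z) => [->|xz] H; first by have := H a; rewrite memE !eqxx.
    by have := H (p x); rewrite memE (negPf xz) xr eqxx.
  rewrite inE; apply/andP; split.
    by apply/forestsP; split=> //; apply/set0Pn; exists (a, z); rewrite setU11.
  apply/forallP => v; apply/negP => av; have /andP[vz _] := av.
  move/(availP _ _ fE): av => [pv vNz].
  have [vr|vr] := eqVneq v r.
    by case/negP: vNz; rewrite vr -[X in connect _ X _]rootr; case: (rootP z fE).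
  have := pv (p v); rewrite memE (negPf vz) vr eqxx => /(_ isT)/eqP.
  by rewrite (negPf (pz v vz vr)).
have := Ec; rewrite inE => /andP[/forestsP[_ fE] noav].
have [din [rk rkE]] := fE; set r := root E z.
have rz : r != z := critical_root Ec; have [rE _] := rootP z fE.
pose par v := odflt z [pick a | (a, v) \in E].
have parE a v : (a, v) \in E -> par v = a.
  by rewrite /par; case: pickP => [b bv av|/(_ a) ->//]; apply: din bv av.
have parP v : v != r -> (par v, v) \in E /\ (v != z -> par v != z).
  by move=> /(critical_parent Ec)[a av az]; rewrite (parE _ _ av).
have zr : z != r by rewrite eq_sym.
have [zE _] := parP z zr.
exists (r, (par z, [ffun v => if v \in ~: [set z; r] then par v else z])).
  rewrite mem_codes rz /=; apply/andP; split.
    by apply: contraTneq (rkE _ _ zE) => ->; rewrite ltnn.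
  apply/flowP; split; last first.
    exists rk => v vS; rewrite ffunE vS; apply: rkE.
    by move: vS; rewrite !inE negb_or => /andP[_ /parP[]].
  apply/mapsP => v; rewrite ffunE; case: ifP => vS; rewrite ?vS //.
  move: vS; rewrite !inE negb_or => /andP[vz /parP[_ /(_ vz)]].
  by case: (eqVneq (par v) z) => //= _ _; rewrite orNb.
apply/setP => -[a v]; rewrite mem_decode //.
have aE w : w != r -> ((a, w) \in E) = (a == par w).
  move=> wr; apply/idP/eqP => [/parE//|->]; by case: (parP w wr).
have [->|vz] := eqVneq v z; first by rewrite aE // eq_sym.
have [->|vr] := eqVneq v r; first by apply/negbTE; move/forallP: rE.
by rewrite aE //= ffunE !inE negb_or vz vr.
Qed.

Theorem card_critical : #|critical z| = (#|I|.-1 ^ #|I|.-1)%N.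
Proof. by rewrite critical_decode (card_in_imset decode_inj) card_codes. Qed.

End CountCritical.

From mathcomp Require Import mathcomp_extra classical_sets functions set_interval.
From mathcomp Require Import topology normedtype homotopy.
Import numFieldNormedType.Exports.
Local Open Scope ring_scope.
Local Open Scope classical_set_scope.

(** * Continuous maps *)

Section Topology.

(** A continuous surjection from a compact space to a Hausdorff space is closed, hence a quotient
    map. *)
Lemma quotient_map_continuous (X Y Z : topologicalType) (q : X -> Y) (f : Y -> Z) :
    compact [set: X] -> hausdorff_space Y -> continuous q ->
    (forall y, exists x, q x = y) -> continuous (f \o q) ->
  continuous f.
Proof.
move=> cX hY cq q_surj cfq; apply/continuous_closedP => C cC.
have -> : f @^-1` C = q @` ((f \o q) @^-1` C).
  apply/seteqP; split=> [y Cy|_ [x Cx <-]] //=.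
  by have [x xy] := q_surj y; exists x => //=; rewrite xy.
apply: compact_closed => //; apply: continuous_compact.
  exact: continuous_subspaceT.
apply: subclosed_compact cX _ => //.
by move/continuous_closedP: cfq; apply.
Qed.

Lemma set_type_continuous (X Z : topologicalType) (A : set X) (f : Z -> set_type A) :
  continuous (fun z => \val (f z) : X) -> continuous f.
Proof. exact: (@continuous_comp_initial (set_type A) Z X set_val f). Qed.

Lemma val_continuous (X : topologicalType) (A : set X) :
  continuous (fun a : set_type A => \val a : X).
Proof. exact: initial_continuous. Qed.

Lemma set_type_compact (X : topologicalType) (A : set X) :
  compact A -> compact [set: set_type A].
Proof.
move=> cA F FF _; pose G := (fun a : set_type A => \val a : X) @ F.
have [|a [Aa aG]] := cA G _.
  by apply: (@filterS _ F _ setT) => [a _|]; [exact: (set_mem (valP a))|exact: filterT].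
exists (exist _ a (mem_set Aa)); split=> // B U FB [W [[O oO <-] Oa OU]].
have GB : G ((fun a : set_type A => \val a : X) @` B).
  by apply: (@filterS _ F _ B) FB => b Bb; exists b.
have [|_ [[b Bb <-] Ob]] := aG _ O GB; first exact: open_nbhs_nbhs.
by exists b; split=> //; apply: OU.
Qed.

Lemma set_type_hausdorff (X : topologicalType) (A : set X) :
  hausdorff_space X -> hausdorff_space (set_type A).
Proof.
move=> hX a b ab; apply: val_inj; apply: hX => U V nU nV.
have [c [Uc Vc]] := ab _ _ (val_continuous nU) (val_continuous nV).
by exists (\val c).
Qed.

Lemma ptws_continuous (Z : topologicalType) (I : eqType) (X : topologicalType)
    (f : Z -> {ptws I -> X}) :
  (forall i, continuous (fun z => f z i)) -> continuous f.
Proof.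
move=> cf z; apply/cvg_sup => i.
apply: (@continuous_comp_initial {ptws I -> X} Z X (fun h => h i) f).
exact: cf.
Qed.

Lemma ptws_eval_continuous (I : eqType) (X : topologicalType) (i : I) :
  continuous (fun h : {ptws I -> X} => h i).
Proof. exact: (@proj_continuous I (fun=> X) i). Qed.

Lemma rV_continuous (Z : topologicalType) (R : realType) (n : nat)
    (f : Z -> 'rV[R]_n) :
  (forall i, continuous (fun z => f z 0 i)) -> continuous f.
Proof.
move=> cf z U /= [P nP PU].
have : \forall w \near z, forall i, P 0 i (f w 0 i).
  apply: filter_forall => i; apply: (cf i z).
  exact: nP.
apply: filterS => w Pw; apply: PU => i j; rewrite ord1; exact: Pw.
Qed.

End Topology.

Section ContinuousFunctions.
Variables (R : realType) (Z : topologicalType).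
Implicit Types f g : Z -> R.

Lemma comp_continuous (X Y : topologicalType) (f : Z -> X) (g : X -> Y) :
  continuous f -> continuous g -> continuous (fun z => g (f z)).
Proof. by move=> cf cg z; exact: (continuous_comp (cf z) (cg (f z))). Qed.

Lemma pair_continuous (X Y : topologicalType) (f : Z -> X) (g : Z -> Y) :
  continuous f -> continuous g -> continuous (fun z => (f z, g z)).
Proof. by move=> cf cg z; exact: (cvg_pair (cf z) (cg z)). Qed.

Lemma fst_continuous (X Y : topologicalType) : continuous (fst : X * Y -> X).
Proof. by move=> p; exact: cvg_fst. Qed.

Lemma snd_continuous (X Y : topologicalType) : continuous (snd : X * Y -> Y).
Proof. by move=> p; exact: cvg_snd. Qed.

Lemma const_continuous (X : topologicalType) (c : X) : continuous (fun _ : Z => c).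
Proof. by move=> z; exact: cvg_cst. Qed.

Lemma add_continuous f g :
  continuous f -> continuous g -> continuous (fun z => f z + g z).
Proof. by move=> cf cg z; exact: cvgD (cf z) (cg z). Qed.

Lemma sub_continuous f g :
  continuous f -> continuous g -> continuous (fun z => f z - g z).
Proof. by move=> cf cg z; exact: cvgB (cf z) (cg z). Qed.

Lemma mul_continuous f g :
  continuous f -> continuous g -> continuous (fun z => f z * g z).
Proof. by move=> cf cg z; exact: cvgM (cf z) (cg z). Qed.

Lemma div_continuous f g : (forall z, g z != 0) ->
  continuous f -> continuous g -> continuous (fun z => f z / g z).
Proof. by move=> g0 cf cg z; exact: cvgM (cf z) (cvgV (g0 z) (cg z)). Qed.

Lemma min_fun_continuous f g :
  continuous f -> continuous g -> continuous (fun z => Num.min (f z) (g z)).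
Proof. by move=> cf cg z; exact: (continuous_min (cf z) (cg z)). Qed.

Lemma max_fun_continuous f g :
  continuous f -> continuous g -> continuous (fun z => Num.max (f z) (g z)).
Proof. by move=> cf cg z; exact: (continuous_max (cf z) (cg z)). Qed.

Lemma sum_continuous (I : Type) (r : seq I) (P : pred I) (F : I -> Z -> R) :
  (forall i, continuous (F i)) -> continuous (fun z => \sum_(i <- r | P i) F i z).
Proof.
move=> cF; elim: r => [|i r IHr].
  under eq_fun do rewrite big_nil.
  by move=> z; exact: cvg_cst.
under eq_fun do rewrite big_cons.
by case: (P i) => //; apply: add_continuous.
Qed.

Lemma bigmin_continuous (I : Type) (x0 : R) (r : seq I) (P : pred I) (F : I -> Z -> R) :
  (forall i, continuous (F i)) ->
  continuous (fun z => \big[Num.min/x0]_(i <- r | P i) F i z).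
Proof.
move=> cF; elim: r => [|i r IHr].
  under eq_fun do rewrite big_nil.
  by move=> z; exact: cvg_cst.
under eq_fun do rewrite big_cons.
by case: (P i) => //; apply: min_fun_continuous.
Qed.

End ContinuousFunctions.

(** * Homotopies *)

Section TotalHomotopies.
Variable R : realType.

(* Homotopies defined and continuous for all real times avoid subspaces of     *)
(* X * R.                                                                      *)
Definition total_homotopic (X Y : topologicalType) (f g : X -> Y) : Prop :=
  exists H : X * R -> Y,
    [/\ continuous H, forall x, H (x, 0) = f x & forall x, H (x, 1) = g x].

Lemma total_homotopic_homotopic (X Y : topologicalType) (f g : X -> Y) :
  total_homotopic f g -> homotopic R f g.
Proof. by case=> H [cH H0 H1]; exists H; split=> //; apply: continuous_subspaceT. Qed.

Lemma total_homotopic_trans (X Y : topologicalType) (f g h : X -> Y) :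
  total_homotopic f g -> total_homotopic g h -> total_homotopic f h.
Proof.
move=> [H [cH H0 H1]] [K [cK K0 K1]].
(* The [min] and [max] stop each homotopy at the junction, where both closed pieces then agree. *)
pose L (p : X * R) := if p.2 <= 1 / 2 then H (p.1, Num.min 1 (2 * p.2))
  else K (p.1, Num.max 0 (2 * p.2 - 1)).
have c2 : continuous (fun p : X * R => 2 * p.2 : R).
  by apply: mul_continuous (@snd_continuous _ _) => p; exact: cvg_cst.
have cL1 : continuous (fun p : X * R => H (p.1, Num.min 1 (2 * p.2))).
  apply: (comp_continuous _ cH); apply: pair_continuous; first exact: fst_continuous.
  by apply: min_fun_continuous c2 => p; exact: cvg_cst.
have cL2 : continuous (fun p : X * R => K (p.1, Num.max 0 (2 * p.2 - 1))).
  apply: (comp_continuous _ cK); apply: pair_continuous; first exact: fst_continuous.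
  apply: max_fun_continuous; first by move=> p; exact: cvg_cst.
  by apply: sub_continuous c2 _ => p; exact: cvg_cst.
pose A : set (X * R) := [set p | p.2 <= 1 / 2].
pose B : set (X * R) := [set p | 1 / 2 <= p.2].
have cA : closed A.
  by apply: (@closed_comp _ _ snd [set t : R | t <= 1 / 2]) => // p _; exact: cvg_snd.
have cB : closed B.
  by apply: (@closed_comp _ _ snd [set t : R | 1 / 2 <= t]) => // p _; exact: cvg_snd.
have AB : A `|` B = setT.
  by apply/seteqP; split=> // p _; rewrite /A /B /=; case: (leP p.2 (1/2)) => [|/ltW]; [left|right].
exists L; split.
- apply/continuous_subspace_setT; rewrite -AB; apply: withinU_continuous => //.
    apply: subspace_eq_continuous (continuous_subspaceT cL1) => p.
    by rewrite inE => pA; rewrite /from_subspace /L ifT.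
  apply: subspace_eq_continuous (continuous_subspaceT cL2) => p.
  rewrite inE => hp; rewrite /from_subspace /L /=; case: ifP => // hp'.
  have -> : 2 * p.2 = 1 by move: hp hp'; rewrite /B /=; lra.
  rewrite subrr maxxx minxx.
  by rewrite K0 H1.
- by move=> x; rewrite /L /= mulr0 divr_ge0 // min_r // H0.
- move=> x; rewrite /L /= mulr1 ifF; last by apply/negbTE; rewrite -ltNge; lra.
  by rewrite max_r; [rewrite (_ : 2 - 1 = 1 :> R) ?K1 //; lra|lra].
Qed.

Lemma total_homotopic_comp (X Y Z W : topologicalType) (k : W -> X) (f g : X -> Y)
    (l : Y -> Z) : continuous k -> continuous l ->
  total_homotopic f g -> total_homotopic (l \o f \o k) (l \o g \o k).
Proof.
move=> ck cl [H [cH H0 H1]]; exists (fun p => l (H (k p.1, p.2))); split=> [|x|x] /=.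
- apply: (comp_continuous _ cl); apply: (comp_continuous _ cH).
  apply: pair_continuous; last exact: snd_continuous.
  by apply: (comp_continuous _ ck); exact: fst_continuous.
- by rewrite H0.
- by rewrite H1.
Qed.

Definition total_equivalent (X Y : topologicalType) : Prop :=
  exists (f : X -> Y) (g : Y -> X), [/\ continuous f, continuous g,
    total_homotopic (g \o f) idfun & total_homotopic (f \o g) idfun].

Lemma total_equivalent_homotopy_equivalent (X Y : topologicalType) :
  total_equivalent X Y -> homotopy_equivalent R X Y.
Proof.
move=> [f [g [cf cg gf fg]]]; exists f, g.
by split=> //; apply: total_homotopic_homotopic.
Qed.

Lemma total_equivalent_trans (X Y Z : topologicalType) :
  total_equivalent X Y -> total_equivalent Y Z -> total_equivalent X Z.
Proof.
move=> [f [g [cf cg gf fg]]] [f' [g' [cf' cg' gf' fg']]].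
exists (f' \o f), (g \o g'); split.
- exact: comp_continuous cf cf'.
- exact: comp_continuous cg' cg.
- by apply: total_homotopic_trans gf; apply: (total_homotopic_comp cf cg gf').
- by apply: total_homotopic_trans fg'; apply: (total_homotopic_comp cg' cf' fg).
Qed.

Definition clamp (t : R) : R := Num.min 1 (Num.max 0 t).

Lemma clamp_continuous : continuous clamp.
Proof.
apply: min_fun_continuous; first by move=> t; exact: cvg_cst.
by apply: max_fun_continuous => t; [exact: cvg_cst|exact: cvg_id].
Qed.

Lemma clamp_itv t : `[0, 1] (clamp t).
Proof.
rewrite /= in_itv /= /clamp le_min ler01 /= ge_min lexx /=.
by rewrite le_max lexx.
Qed.

Lemma clampE t : 0 <= t <= 1 -> clamp t = t.
Proof. by case/andP=> t0 t1; rewrite /clamp max_r // min_r. Qed.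

Lemma prod_hausdorff (X Y : topologicalType) :
  hausdorff_space X -> hausdorff_space Y -> hausdorff_space (X * Y)%type.
Proof.
move=> hX hY [x y] [x' y'] xy; congr (_, _).
  apply: hX => U V nU nV; have [||p [Up Vp]] := xy (fst @^-1` U) (fst @^-1` V).
  - exact: (@cvg_fst _ _ (nbhs x) (nbhs y)) U nU.
  - exact: (@cvg_fst _ _ (nbhs x') (nbhs y')) V nV.
  by exists p.1.
apply: hY => U V nU nV; have [||p [Up Vp]] := xy (snd @^-1` U) (snd @^-1` V).
- exact: (@cvg_snd _ _ (nbhs x) (nbhs y)) U nU.
- exact: (@cvg_snd _ _ (nbhs x') (nbhs y')) V nV.
by exists p.2.
Qed.

(* Collapsing to a point a subspace that the deformation h of X contracts.     *)
Lemma quotient_equivalent (X W : topologicalType) (q : X -> W) (h : X * R -> X)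
    (A : set X) (p : X) :
    compact [set: X] -> hausdorff_space W -> continuous q ->
    (forall w, exists x, q x = w) ->
    (forall x y, q x = q y -> x = y \/ A x /\ A y) ->
    (forall x y, A x -> A y -> q x = q y) ->
    continuous h -> (forall x, h (x, 0) = x) ->
    (forall x t, 0 <= t <= 1 -> A x -> A (h (x, t))) ->
    (forall x, A x -> h (x, 1) = p) ->
  total_equivalent X W.
Proof.
move=> cX hW cq /choice[s sK] q_inj qA ch h0 hA h1.
have qh x y t : 0 <= t <= 1 -> q x = q y -> q (h (x, t)) = q (h (y, t)).
  by move=> t01 /q_inj[->//|[Ax Ay]]; apply: qA; apply: hA.
have h1s x : h (s (q x), 1) = h (x, 1).
  by have [->//|[Ax Ay]] := q_inj (s (q x)) x (sK _); rewrite !h1.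
have cht t : continuous (fun x => h (x, t)).
  apply: (comp_continuous _ ch); apply: pair_continuous => x; first exact: cvg_id.
  exact: cvg_cst.
have c1B (Y : topologicalType) : continuous (fun y : Y * R => (y.1, 1 - y.2)).
  apply: pair_continuous; first exact: fst_continuous.
  by apply: sub_continuous (@snd_continuous _ _) => y; exact: cvg_cst.
pose g w := h (s w, 1).
exists q, g; split=> //.
- apply: (quotient_map_continuous cX hW cq) => [w|]; first by exists (s w).
  have -> : g \o q = fun x => h (x, 1) by apply/funext => x; exact: h1s.
  exact: cht.
- exists (fun y => h (y.1, 1 - y.2)); split=> [|x|x] /=.
  + exact: comp_continuous (c1B X) ch.
  + by rewrite subr0 /g h1s.
  + by rewrite subrr.
(* Restricting time to [0, 1] makes X * I compact, so the homotopy descends to the quotient; [clamp]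
   extends it to all times afterwards. *)
pose I := set_type (`[0, 1] : set R).
pose K (y : W * I) := q (h (s y.1, 1 - \val y.2)).
have cK : continuous K.
  apply: (@quotient_map_continuous (X * I)%type _ _ (fun y => (q y.1, y.2)) K).
  - have -> : [set: X * I] = [set: X] `*` [set: I] by apply/seteqP; split.
    apply: compact_setX => //; apply: set_type_compact; exact: segment_compact.
  - apply: prod_hausdorff => //; apply: set_type_hausdorff; exact: Rhausdorff.
  - apply: pair_continuous; last exact: snd_continuous.
    by apply: (comp_continuous _ cq); exact: fst_continuous.
  - by move=> [w i]; exists (s w, i); rewrite /= sK.
  have -> : K \o (fun y : X * I => (q y.1, y.2)) = fun y => q (h (y.1, 1 - \val y.2)).
    apply/funext => -[x i]; rewrite /K /=; apply: qh; last by rewrite sK.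
    have := set_mem (valP i); rewrite /= in_itv /=; lra.
  apply: (comp_continuous _ cq); apply: (comp_continuous _ ch).
  apply: pair_continuous; first exact: fst_continuous.
  apply: sub_continuous; first by move=> y; exact: cvg_cst.
  by apply: (comp_continuous _ (@val_continuous _ _)); exact: snd_continuous.
pose to_I t : I := exist _ (clamp t) (mem_set (clamp_itv t)).
exists (fun y => K (y.1, to_I y.2)); split=> [|w|w].
- apply: (comp_continuous _ cK); apply: pair_continuous; first exact: fst_continuous.
  apply: (comp_continuous (@snd_continuous _ _)).
  apply: (@set_type_continuous _ _ _ to_I).
  exact: clamp_continuous.
- by rewrite /K /= clampE ?lexx ?ler01 // subr0.
- by rewrite /K /= clampE ?lexx ?ler01 // subrr h0 sK.
Qed.

End TotalHomotopies.

(** * Realizations *)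

Section Realizations.
Variables (R : realType) (V : finType).
Implicit Types (K L M : {set {set V}}) (s t : {set V}) (x y : {ptws V -> R}).

Definition support x : {set V} := finset (fun v => x v != 0).

Lemma mem_support x v : (v \in support x) = (x v != 0).
Proof. by rewrite inE. Qed.

Lemma barycentric_face K t x : is_complex K -> t \in K -> (forall v, 0 <= x v) ->
  \sum_v x v = 1 -> support x \subset t -> barycentric R K x.
Proof.
move=> [_ Kd] tK x0 x1 xt; split=> //; apply: Kd tK xt _.
apply: contraTneq (oner_neq0 R) => sx; rewrite -x1 big1 ?eqxx // => v _.
by apply/eqP/negbFE; rewrite -mem_support [support x]sx inE.
Qed.

Lemma barycentric_ge0 K x v : barycentric R K x -> 0 <= x v.
Proof. by case. Qed.

Lemma barycentric_le1 K x v : barycentric R K x -> x v <= 1.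
Proof.
by case=> x0 <- _; rewrite (bigD1 v) //= lerDl sumr_ge0.
Qed.

(** Having support in K is rewritten as a finite union, over the faces t, of the closed condition of
    vanishing off t. *)
Lemma barycentric_closed K : is_complex K -> closed (barycentric R K).
Proof.
move=> Kc; have -> : barycentric R K =
    (\bigcap_(v in [set: V]) [set x | 0 <= x v]) `&` [set x | \sum_v x v = 1] `&`
    \bigcup_(t in [set` K]) \bigcap_(v in [set` ~: t]) [set x : {ptws V -> R} | x v = 0].
  apply/seteqP; split=> [x [x0 x1 xK]|x [[x0 x1] [t /= tK xt]]].
    split; first by split=> // v _; apply: x0.
    exists (support x) => // v; rewrite /= finset.in_setC mem_support negbK => /eqP.
    exact.
  apply: (barycentric_face Kc tK) => // [v|]; first exact: x0.
  apply/fintype.subsetP => v; rewrite mem_support; apply: contraNT => vt.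
  by apply/eqP/xt; rewrite /= finset.in_setC.
apply: closedI; first apply: closedI.
- apply: closed_bigI => v _.
  apply: (@closed_comp _ _ (fun x : {ptws V -> R} => x v) [set r : R | 0 <= r]).
    by move=> x _; exact: ptws_eval_continuous.
  exact: closed_ge.
- apply: (@closed_comp _ _ (fun x : {ptws V -> R} => \sum_v x v) [set r : R | r = 1]).
    move=> x _; apply: sum_continuous => v; exact: ptws_eval_continuous.
  exact: closed_eq.
apply: closed_bigcup => // t _; apply: closed_bigI => v _.
apply: (@closed_comp _ _ (fun x : {ptws V -> R} => x v) [set r : R | r = 0]).
  by move=> x _; exact: ptws_eval_continuous.
exact: closed_eq.
Qed.

Lemma barycentric_compact K : is_complex K -> compact (barycentric R K).
Proof.
move=> Kc; apply: (subclosed_compact (barycentric_closed Kc)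
  (@tychonoff V (fun=> R) (fun=> `[0, 1]) (fun=> @segment_compact R 0 1))).
move=> x Kx v; rewrite /= in_itv /= (barycentric_ge0 v Kx).
exact: barycentric_le1 Kx.
Qed.

(** A continuous test for s to lie in the support. The start value 1 bounds all barycentric
    coordinates, so over a nonempty face the minimum is attained. *)
Definition facemin s x : R := \big[Num.min/1]_(w in s) x w.

Lemma facemin_le s x w : w \in s -> facemin s x <= x w.
Proof. by move=> ws; apply: bigmin_le_cond. Qed.

Lemma facemin_ge0 s x : (forall v, 0 <= x v) -> 0 <= facemin s x.
Proof. by move=> x0; apply/bigmin_geP. Qed.

Lemma facemin_gt0 s x : (forall v, 0 <= x v) -> (0 < facemin s x) = (s \subset support x).
Proof.
move=> x0; apply/bigmin_gtP/fintype.subsetP => [[_ H] v /H|H].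
  by rewrite mem_support => /gt_eqF ->.
by split=> // v /H; rewrite mem_support lt_neqAle eq_sym x0 andbT.
Qed.

Lemma facemin_eq0 s x : (forall v, 0 <= x v) -> ~~ (s \subset support x) -> facemin s x = 0.
Proof.
move=> x0; rewrite -facemin_gt0 // -leNgt => le0; apply/eqP.
by rewrite eq_le le0 facemin_ge0.
Qed.

Lemma facemin_attained s x : s != finset.set0 -> (forall v, x v <= 1) ->
  exists2 w, w \in s & facemin s x = x w.
Proof.
move=> /set0Pn[w0 w0s] x1.
have : facemin s x <= facemin s x by [].
rewrite {1}/facemin => /bigmin_leP[h|[w ws h]].
  exists w0 => //; apply/eqP; rewrite eq_le facemin_le //=.
  exact: le_trans (x1 _) h.
by exists w => //; apply/eqP; rewrite eq_le facemin_le.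
Qed.

Lemma facemin_continuous s : continuous (facemin s).
Proof. by apply: bigmin_continuous => v; exact: ptws_eval_continuous. Qed.

(* Pushes the open star of the free face s linearly towards the vertex v of    *)
(* the coface v |: s.                                                          *)
Definition push s (v : V) (p : {ptws V -> R} * R) : {ptws V -> R} :=
  fun w => p.1 w - (w \in s)%:R * (p.2 * facemin s p.1)
           + (w == v)%:R * (#|s|%:R * (p.2 * facemin s p.1)).

Lemma push_continuous s v : continuous (push s v).
Proof.
apply: ptws_continuous => w; have cm : continuous
    (fun p : {ptws V -> R} * R => p.2 * facemin s p.1).
  apply: mul_continuous; first exact: snd_continuous.
  by apply: (comp_continuous _ (@facemin_continuous s)); exact: fst_continuous.
apply: add_continuous; first apply: sub_continuous.
- exact: (comp_continuous (@fst_continuous _ _) (@ptws_eval_continuous V R w)).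
- exact: (@mul_continuous R _ (fun=> (w \in s)%:R) _ (@const_continuous _ _ _) cm).
apply: (@mul_continuous R _ (fun=> (w == v)%:R) _ (@const_continuous _ _ _)).
exact: (@mul_continuous R _ (fun=> #|s|%:R) _ (@const_continuous _ _ _) cm).
Qed.

Lemma push0 s v x : push s v (x, 0) = x.
Proof. by apply/funext => w; rewrite /push /= !(mul0r, mulr0) subr0 addr0. Qed.

Lemma push_fixed s v x l : facemin s x = 0 -> push s v (x, l) = x.
Proof. by move=> e; apply/funext => w; rewrite /push /= e !mulr0 subr0 addr0. Qed.

(** A point whose support contains s has all its mass on v |: s. The push moves the least coordinate
    from every vertex of s to v; at time 1 some vertex of s has left the support, which is then
    neither s nor v |: s. *)
Lemma push_collapse L s (v : V) : is_complex L ->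
    s \in L -> (v |: s)%SET \in L -> v \notin s ->
    (forall u, u \in L -> s \subset u -> u = s \/ u = (v |: s)%SET) ->
  forall x, barycentric R L x ->
    (forall l, 0 <= l <= 1 -> barycentric R L (push s v (x, l))) /\
    barycentric R (L :\: [set s; v |: s])%SET (push s v (x, 1)).
Proof.
move=> Lc sL tL vs free x xL; have [x0 x1 xsupp] := xL; rewrite -/(support x) in xsupp.
have m0 := facemin_ge0 s x0.
have s0 : s != finset.set0 by apply: contraNneq (Lc.1) => <-.
have [mE|mN] := eqVneq (facemin s x) 0.
  have pE l := push_fixed v l mE.
  split=> [l _|]; rewrite pE //; split=> //; rewrite -/(support x).
  have ns : ~~ (s \subset support x) by rewrite -facemin_gt0 // mE ltxx.
  rewrite inE xsupp andbT !inE; apply: contra ns => /orP[]/eqP ->.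
    exact: subxx.
  exact: finset.subsetUr.
have mgt : 0 < facemin s x by rewrite lt_neqAle eq_sym mN.
have ss : s \subset support x by rewrite -facemin_gt0.
have xt : support x \subset (v |: s)%SET.
  by have [->|->] := free _ xsupp ss; rewrite ?finset.subsetUr.
have main l : 0 <= l <= 1 -> [/\ forall w, 0 <= push s v (x, l) w,
    \sum_w push s v (x, l) w = 1 & support (push s v (x, l)) \subset (v |: s)%SET].
  case/andP => l0 l1; split=> [w||].
  - rewrite /push /=; apply: addr_ge0; last by rewrite !mulr_ge0.
    have [ws|ws] := boolP (w \in s); rewrite ?mul0r ?subr0 // mul1r subr_ge0.
    apply: le_trans (facemin_le x ws); rewrite -[leRHS]mul1r.
    exact: ler_wpM2r.
  - rewrite /push /= !big_split /= sumrN -!mulr_suml x1.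
    have -> : \sum_(i : V) (i \in s)%:R = #|s|%:R :> R.
      rewrite -[RHS](sumr_const (mem s) 1) [RHS]big_mkcond /=.
      by apply: eq_bigr => i _; case: (i \in s).
    have -> : \sum_(i : V) (i == v)%:R = 1 :> R.
      by rewrite (bigD1 v) //= eqxx big1 ?addr0 // => i /negPf ->.
    by rewrite mul1r subrK.
  - apply/fintype.subsetP => w; rewrite mem_support; apply: contraNT => wt.
    have : w \notin support x by apply: contra wt; apply: (fintype.subsetP xt).
    rewrite mem_support negbK => /eqP xw; move: wt; rewrite !inE negb_or => /andP[wv ws].
    by rewrite /push /= xw (negPf wv) (negPf ws) !mul0r subr0 addr0.
split=> [l /main[a b c]|]; first exact: barycentric_face c.
have [|a b c] := main 1; first by rewrite ler01 lexx.
split=> //; rewrite -/(support _) !inE.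
have -> : support (push s v (x, 1)) \in L.
  by have [] := barycentric_face Lc tL a b c.
rewrite andbT.
have [w ws mw] := facemin_attained s0 (fun v => barycentric_le1 v xL).
have wp : w \notin support (push s v (x, 1)).
  rewrite mem_support negbK /push /= ws mw mul1r mul1r subrr add0r.
  by rewrite (_ : w == v = false) ?mul0r //; apply: contraNF vs => /eqP <-.
apply: contra wp => /orP[]/eqP ->; first by [].
by rewrite !inE ws orbT.
Qed.

(** T elementary collapses take time T, one push per unit of time. Points of M stay fixed because
    their supports contain none of the free faces. *)
Lemma collapses_deformation K M : is_complex K -> collapses K M ->
  exists (T : nat) (H : {ptws V -> R} * R -> {ptws V -> R}),
    [/\ continuous H, forall x, H (x, 0) = x,
        forall x (u : R), barycentric R K x -> 0 <= u -> barycentric R K (H (x, u)),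
        forall x (u : R), barycentric R K x -> T%:R <= u -> barycentric R M (H (x, u))
      & forall x (u : R), barycentric R M x -> 0 <= u -> H (x, u) = x].
Proof.
move=> Kc KM; elim: KM => [|{}L {}M KL [T [H [cH H0 HK HL Hid]]] elem].
  exists 0%N, fst; split=> //; exact: fst_continuous.
have Lc := collapses_complex Kc KL; have LK := collapses_subset KL.
case: elem => s [t [sL tL [st ct] free eM]].
have [v vt] : exists2 v, v \notin s & t = (v |: s)%SET.
  have /cards1P[v ev] : #|(t :\: s)%SET| == 1%N.
    by rewrite cardsD (finset.setIidPr st) ct subSnn.
  exists v; first by have : v \in (t :\: s)%SET by [rewrite ev inE]; rewrite inE => /andP[].
  apply/finset.setP => w; have /setP/(_ w) := ev; rewrite !inE.
  by have := fintype.subsetP st w; case: (w \in s) => [/(_ isT) -> _|_ /= ->]; rewrite ?orbT ?orbF.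
move=> et; subst t.
have E := push_collapse Lc sL tL vt free.
have LsubK y : barycentric R L y -> barycentric R K y.
  by case=> y0 y1 yL; split=> //; apply: (fintype.subsetP LK).
have MsubL y : barycentric R M y -> barycentric R L y.
  by case=> y0 y1; rewrite eM inE => /andP[_ yL].
have Mmin y : barycentric R M y -> facemin s y = 0.
  move=> yM; have [y0 y1] := yM; rewrite eM -/(support y) inE => /andP[yst yL].
  apply: facemin_eq0 => //; apply: contra yst => /(free _ yL) => -[] ->.
    exact: set21.
  exact: set22.
exists T.+1, (fun p => push s v (H p, clamp (p.2 - T%:R))); split.
- apply: (comp_continuous _ (@push_continuous s v)); apply: pair_continuous cH _.
  apply: (comp_continuous _ (@clamp_continuous R)).
  exact: sub_continuous (@snd_continuous _ _) (@const_continuous _ _ _).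
- move=> x; rewrite H0 /=.
  have -> : clamp (0 - T%:R) = 0 :> R.
    by rewrite /clamp sub0r max_l ?oppr_le0 // min_r.
  exact: push0.
- move=> x u xK u0 /=; have [uT|Tu] := ltP u T%:R.
    have -> : clamp (u - T%:R) = 0 :> R.
      by rewrite /clamp max_l ?min_r // subr_le0 ltW.
    by rewrite push0; apply: HK.
  apply: LsubK; apply: (E _ (HL x u xK Tu)).1.
  by have := clamp_itv (u - T%:R); rewrite /= in_itv.
- move=> x u xK Tu /=.
  have -> : clamp (u - T%:R) = 1 :> R.
    rewrite /clamp min_l // le_max; apply/orP; right.
    by rewrite lerBrDr addrC natr1.
  rewrite eM; apply: (E _ _).2; apply: HL => //.
  by apply: le_trans Tu; rewrite ler_nat.
move=> x u xM u0 /=; rewrite Hid //; last exact: MsubL.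
by rewrite push_fixed // Mmin.
Qed.

End Realizations.

(** * Simplices and spheres *)

(* The interior of a d-simplex is identified with R^d through                  *)
(*   x |-> z = ((x_j - x_0) / m)_j where m is the least coordinate of x;       *)
(* the least coordinate of x / m being 1, x is recovered from z as the         *)
(* multiple of (z_j + 1 - min z)_j of total mass 1. Composing with the inverse *)
(* stereographic projection extends continuously to the boundary m = 0, which  *)
(* is sent to the pole.                                                        *)
Section FacetSphere.
Variables (R : realType) (V : finType) (d : nat) (F : {set V}).
Hypothesis cF : #|F| = d.+1.
Implicit Types (x y : {ptws V -> R}) (j : 'I_d.+1).

Let v0F : exists v0, v0 \in F.
Proof. by apply/card_gt0P; rewrite cF. Qed.

Definition corner (j : 'I_d.+1) : V := nth (xchoose v0F) (enum F) j.

Lemma corner_in j : corner j \in F.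
Proof. by rewrite -mem_enum mem_nth // -cardE cF. Qed.

Lemma cornerP v : v \in F -> exists j, corner j = v.
Proof.
rewrite -mem_enum => vF; have := vF; rewrite -index_mem -cardE cF => lt.
by exists (Ordinal lt); rewrite /corner nth_index.
Qed.

Lemma corner_inj : injective corner.
Proof.
move=> i j /eqP; rewrite nth_uniq ?enum_uniq -?cardE ?cF // => /eqP.
exact: val_inj.
Qed.

Lemma sum_corner (G : V -> R) : \sum_(v in F) G v = \sum_j G (corner j).
Proof. by rewrite -big_enum (big_nth (xchoose v0F)) -cardE cF big_mkord. Qed.

Definition slope x j : R := x (corner j) - x (corner ord0).

(** Zero when all mass lies on F; it keeps the denominator of [facet_sphere] positive where all
    coordinates on F vanish. *)
Definition defect x : R := 1 - \sum_(v in F) x v.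

Definition spread x : R := \sum_j slope x j ^+ 2 + defect x ^+ 2.

(** Inverse stereographic projection of slope / m with m = [facemin F x], both numerator and
    denominator multiplied by m ^ 2. As slope 0 is always 0, coordinate 0 is free to hold the
    height. *)
Definition facet_sphere x : 'rV[R]_d.+1 :=
  \row_j ((2 * facemin F x * slope x j
           + (j == ord0)%:R * (spread x - facemin F x ^+ 2))
          / (spread x + facemin F x ^+ 2)).

Lemma slope0 x : slope x ord0 = 0. Proof. exact: subrr. Qed.

Lemma spread_ge0 x : 0 <= spread x.
Proof. by rewrite addr_ge0 ?sqr_ge0 // sumr_ge0 // => j _; apply: sqr_ge0. Qed.

Section Normalized.
Variable x : {ptws V -> R}.
Hypothesis x_ge0 : forall v, 0 <= x v.
Hypothesis x_le1 : forall v, x v <= 1.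
Hypothesis x_in : 0 < facemin F x -> \sum_(v in F) x v = 1.

(** If the least coordinate on F and all slopes vanish, then x is 0 on F and the defect is 1. *)
Lemma denominator_gt0 : 0 < spread x + facemin F x ^+ 2.
Proof.
have m0 := facemin_ge0 F x_ge0.
have [mgt|mle] := ltP 0 (facemin F x); first by rewrite ltr_wpDl ?spread_ge0 // exprn_gt0.
have mE : facemin F x = 0 by apply/eqP; rewrite eq_le mle m0.
rewrite mE expr0n addr0 lt_neqAle spread_ge0 andbT eq_sym; apply/negP.
rewrite /spread paddr_eq0 ?sqr_ge0 ?sumr_ge0 // => [/andP[s0 d0]|j _]; last exact: sqr_ge0.
have [w wF mw] : exists2 w, w \in F & facemin F x = x w.
  by apply: facemin_attained x_le1; rewrite -card_gt0 cF.
have sl j : slope x j = 0.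
  move: s0; rewrite psumr_eq0 => [/allP/(_ j)|i _]; last exact: sqr_ge0.
  by rewrite mem_index_enum sqrf_eq0 => /(_ isT)/eqP.
have [j0 ej0] := cornerP wF.
have xc j : x (corner j) = 0.
  have := sl j; have := sl j0; rewrite /slope ej0 -mw mE; lra.
move: d0; rewrite sqrf_eq0 /defect sum_corner big1 // subr0.
by rewrite oner_eq0.
Qed.

Lemma facet_sphere_on_sphere : sphere R d (facet_sphere x).
Proof.
have D0 := denominator_gt0.
(* The squares sum to 1 up to a term in the square of this product. *)
have mdef : facemin F x * defect x = 0.
  have [mgt|mle] := ltP 0 (facemin F x); first by rewrite /defect x_in // subrr mulr0.
  have -> : facemin F x = 0 by apply/eqP; rewrite eq_le mle facemin_ge0.
  by rewrite mul0r.
rewrite /sphere /=.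
have e j : facet_sphere x 0 j ^+ 2 = (4 * facemin F x ^+ 2 * slope x j ^+ 2
    + (j == ord0)%:R * (spread x - facemin F x ^+ 2) ^+ 2)
    / (spread x + facemin F x ^+ 2) ^+ 2.
  rewrite mxE expr_div_n; congr (_ / _); have [->|_] := eqVneq j ord0.
    by rewrite slope0 !mulr0 !mul1r !add0r expr0n /= mulr0 add0r.
  by rewrite !mul0r !addr0; ring.
rewrite (eq_bigr _ (fun j _ => e j)) -mulr_suml big_split /= -mulr_sumr.
rewrite -mulr_suml (_ : \sum_j (j == ord0)%:R = 1 :> R) ?mul1r; last first.
  by rewrite (bigD1 (ord0 : 'I_d.+1)) //= big1 ?addr0 // => j /negPf ->.
have D2 : (spread x + facemin F x ^+ 2) ^+ 2 != 0 by rewrite expf_neq0 // gt_eqF.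
apply/eqP; rewrite -(inj_eq (mulIf D2)) divfK // mul1r; apply/eqP.
rewrite /spread; set A := \sum_j _.
have md2 : facemin F x ^+ 2 * defect x ^+ 2 = 0 by rewrite -exprMn mdef expr0n.
rewrite -[LHS]addr0 -[X in _ + X](mulr0 4) -md2; ring.
Qed.

Lemma facet_sphere0 : facet_sphere x 0 ord0 =
  (spread x - facemin F x ^+ 2) / (spread x + facemin F x ^+ 2).
Proof. by rewrite mxE slope0 mulr0 add0r eqxx mul1r. Qed.

Lemma facet_sphere_other j : j != ord0 -> facet_sphere x 0 j =
  2 * facemin F x * slope x j / (spread x + facemin F x ^+ 2).
Proof. by move=> /negPf j0; rewrite mxE j0 mul0r addr0. Qed.

Lemma one_sub_facet_sphere0 : 1 - facet_sphere x 0 ord0 =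
  2 * facemin F x ^+ 2 / (spread x + facemin F x ^+ 2).
Proof. by rewrite facet_sphere0; have := denominator_gt0 => D0; field; rewrite gt_eqF. Qed.

Lemma facet_sphere_pole : facemin F x = 0 -> facet_sphere x = delta_mx 0 ord0.
Proof.
move=> m0; apply/rowP => j; rewrite mxE m0 !(mulr0, mul0r) expr0n /= subr0 addr0 add0r.
have := denominator_gt0; rewrite m0 expr0n /= addr0 => D0.
by rewrite !mxE eqxx /= mulfK // gt_eqF.
Qed.

Lemma facet_sphere_not_pole : 0 < facemin F x -> facet_sphere x != delta_mx 0 ord0.
Proof.
move=> mgt; apply/eqP => e; have := one_sub_facet_sphere0.
rewrite e mxE !eqxx subrr => /esym/eqP.
by rewrite gt_eqF // divr_gt0 ?denominator_gt0 // mulr_gt0 // exprn_gt0.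
Qed.

Lemma slope_facet_sphere j : 0 < facemin F x ->
  slope x j = facemin F x * (if j == ord0 then 0
     else facet_sphere x 0 j / (1 - facet_sphere x 0 ord0)).
Proof.
move=> mgt; case: eqVneq => [->|j0]; first by rewrite slope0 mulr0.
rewrite facet_sphere_other // one_sub_facet_sphere0.
by have D0 := denominator_gt0; field; rewrite !gt_eqF.
Qed.

End Normalized.

Lemma facet_sphere_inj x y :
    (forall v, 0 <= x v) -> (forall v, x v <= 1) -> \sum_v x v = 1 ->
    (forall v, 0 <= y v) -> (forall v, y v <= 1) -> \sum_v y v = 1 ->
    support x = F -> support y = F -> facet_sphere x = facet_sphere y -> x = y.
Proof.
move=> x0 x1 xs y0 y1 ys sx sy e.
have sumF (u : {ptws V -> R}) : support u = F -> \sum_v u v = 1 -> \sum_(v in F) u v = 1.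
  move=> su us; rewrite big_mkcond -[RHS]us; apply: eq_bigr => v _.
  by rewrite -su mem_support; case: eqP.
have [xF yF] := (sumF x sx xs, sumF y sy ys).
have mx : 0 < facemin F x by rewrite facemin_gt0 // sx.
have my : 0 < facemin F y by rewrite facemin_gt0 // sy.
pose z (j : 'I_d.+1) := if j == ord0 then 0
     else facet_sphere x 0 j / (1 - facet_sphere x 0 ord0).
have zx j : slope x j = facemin F x * z j.
  by apply: slope_facet_sphere.
have zy j : slope y j = facemin F y * z j.
  by rewrite /z e; apply: slope_facet_sphere.
have F0 : F != finset.set0 by rewrite -card_gt0 cF.
pose c (u : {ptws V -> R}) := u (corner ord0) / facemin F u.
have coord u j : 0 < facemin F u -> slope u j = facemin F u * z j ->
    u (corner j) = facemin F u * (z j + c u).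
  move=> mu su; rewrite mulrDr -su /c mulrC divfK ?gt_eqF // /slope.
  by rewrite subrK.
have least u : 0 < facemin F u -> (forall v, u v <= 1) ->
    (forall j, slope u j = facemin F u * z j) ->
    (forall j, 1 <= z j + c u) /\ exists j, z j + c u = 1.
  move=> mu u1 su; split=> [j|].
    have := facemin_le u (corner_in j); rewrite (coord u j) // -[leLHS]mulr1.
    by rewrite ler_pM2l.
  have [w wF mw] := facemin_attained F0 u1; have [j ej] := cornerP wF.
  exists j; apply/eqP; rewrite -(inj_eq (mulfI (lt0r_neq0 mu))) -coord // ej mulr1.
  by rewrite -mw.
(* Both constants equal 1 - min z. *)
have cc : c x = c y.
  have [gex [jx ex]] := least x mx x1 zx; have [gey [jy ey]] := least y my y1 zy.
  have := gex jy; have := gey jx; lra.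
have mm : facemin F x = facemin F y.
  have S u : 0 < facemin F u -> (forall j, slope u j = facemin F u * z j) ->
      \sum_(v in F) u v = facemin F u * \sum_j (z j + c u).
    by move=> mu su; rewrite sum_corner mulr_sumr; apply: eq_bigr => j _; rewrite -coord.
  have := S x mx zx; have := S y my zy; rewrite xF yF -cc => e1 e2.
  have S0 : \sum_j (z j + c x) != 0.
    by apply: contraTneq (oner_neq0 R) => h; rewrite e1 h mulr0 eqxx.
  by apply: (mulIf S0); rewrite -e1 -e2.
apply/funext => v; have [vF|vF] := boolP (v \in F).
  by have [j <-] := cornerP vF; rewrite !coord // mm cc.
have xv : v \notin support x by rewrite sx.
have yv : v \notin support y by rewrite sy.
by move: xv yv; rewrite !mem_support !negbK => /eqP -> /eqP ->.
Qed.

Lemma facet_sphere_surj (s : 'rV[R]_d.+1) : sphere R d s -> s != delta_mx 0 ord0 ->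
  exists x, [/\ forall v, 0 <= x v, \sum_v x v = 1, support x = F & facet_sphere x = s].
Proof.
rewrite /sphere /= (bigD1 (ord0 : 'I_d.+1)) //= => sS snp.
set T := \sum_(i < _ | _) _ in sS.
have T0 : 0 <= T by apply: sumr_ge0 => i _; apply: sqr_ge0.
have s1 : s 0 ord0 < 1.
  rewrite lt_neqAle; apply/andP; split; last first.
    by have := sqr_ge0 (s 0 ord0 - 1); have := sqr_ge0 (s 0 ord0); nra.
  apply: contra snp => /eqP e; apply/eqP/rowP => j; rewrite !mxE eqxx /=.
  have [->|j0] := eqVneq j ord0; first by rewrite e.
  have : T == 0 by apply/eqP; move: sS; rewrite e; lra.
  rewrite psumr_eq0 => [/allP/(_ j)|i _]; last exact: sqr_ge0.
  by rewrite mem_index_enum j0 sqrf_eq0 => /(_ isT)/eqP ->.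
pose z (j : 'I_d.+1) := if j == ord0 then 0 else s 0 j / (1 - s 0 ord0).
have [j0 _ jmin] : exists2 j0, true & forall j, z j0 <= z j.
  by case: (arg_minP z (i0 := ord0 : 'I_d.+1) (P := xpredT)) => // j0 _ h;
     exists j0 => // j; apply: h.
(* The coordinates of the preimage up to scale; their minimum 1, at j0, becomes 1 / S after
   normalization. *)
pose a j := z j - z j0 + 1; have a1 j : 1 <= a j by have := jmin j; rewrite /a; lra.
pose S := \sum_j a j; have S0 : 0 < S.
  rewrite /S (bigD1 j0) //= ltr_pwDl ?sumr_ge0 //.
    exact: lt_le_trans ltr01 (a1 j0).
  by move=> i _; apply: le_trans ler01 (a1 i).
pose x : {ptws V -> R} := fun v => \sum_j (corner j == v)%:R * (a j / S).
have xc j : x (corner j) = a j / S.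
  rewrite /x (bigD1 j) //= eqxx mul1r big1 ?addr0 // => i ij.
  by rewrite (inj_eq corner_inj) (negPf ij) mul0r.
have xout v : v \notin F -> x v = 0.
  move=> vF; rewrite /x big1 // => j _; rewrite (_ : corner j == v = false) ?mul0r //.
  by apply: contraNF vF => /eqP <-; apply: corner_in.
have a0 j : 0 < a j / S by rewrite divr_gt0 // (lt_le_trans ltr01).
have x0 v : 0 <= x v by apply: sumr_ge0 => j _; rewrite mulr_ge0 // ltW.
have sumF : \sum_(v in F) x v = 1.
  by rewrite sum_corner (eq_bigr _ (fun j _ => xc j)) -mulr_suml divff ?gt_eqF.
have sumV : \sum_v x v = 1.
  rewrite (bigID (mem F)) /= sumF big1 ?addr0 // => v; exact: xout.
have sx : support x = F.
  apply/finset.setP => v; rewrite mem_support; have [vF|/xout ->] := boolP (v \in F).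
    by have [j <-] := cornerP vF; rewrite xc gt_eqF.
  by rewrite eqxx.
have x1 v : x v <= 1 by rewrite -sumV (bigD1 v) //= lerDl sumr_ge0.
exists x; split=> //.
have F0 : F != finset.set0 by rewrite -card_gt0 cF.
have mE : facemin F x = 1 / S.
  apply/eqP; rewrite eq_le; apply/andP; split.
    have := facemin_le x (corner_in j0).
    by rewrite xc /a subrr add0r.
  have [w wF ->] := facemin_attained F0 x1; have [j <-] := cornerP wF.
  by rewrite xc ler_pM2r ?invr_gt0.
have slE j : slope x j = z j / S.
  have z0 : z ord0 = 0 by rewrite /z eqxx.
  by rewrite /slope !xc -mulrBl /a z0; congr (_ / _); ring.
have dE : defect x = 0 by rewrite /defect sumF subrr.
have qE : spread x = (T / (1 - s 0 ord0) ^+ 2) / S ^+ 2.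
  rewrite /spread dE expr0n addr0 (bigD1 (ord0 : 'I_d.+1)) //= slope0 expr0n add0r.
  rewrite /T !mulr_suml; apply: eq_bigr => j jn0; rewrite slE /z (negPf jn0).
  by rewrite !expr_div_n.
have s1' : 1 - s 0 ord0 != 0 by rewrite subr_eq0 gt_eqF.
have S0' : S != 0 by rewrite gt_eqF.
have TE : T = 1 - s 0 ord0 ^+ 2 by rewrite -sS; ring.
have qE' : spread x = (1 + s 0 ord0) / (1 - s 0 ord0) / S ^+ 2.
  by rewrite qE TE; field; rewrite s1' S0'.
have sE : spread x + facemin F x ^+ 2 = 2 / (1 - s 0 ord0) / S ^+ 2.
  by rewrite qE' mE; field; rewrite s1' S0'.
apply/rowP => j; have [->|jn0] := eqVneq j ord0.
  by rewrite facet_sphere0 sE qE' mE; field; rewrite s1' S0'.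
rewrite facet_sphere_other // sE mE slE /z (negPf jn0).
by field; rewrite s1' S0'.
Qed.

Lemma facet_sphere_continuous (Z : topologicalType) (f : Z -> {ptws V -> R}) :
    continuous f -> (forall z, spread (f z) + facemin F (f z) ^+ 2 != 0) ->
  continuous (fun z => facet_sphere (f z)).
Proof.
move=> cf D0; apply: rV_continuous => j; under eq_fun do rewrite mxE.
have cm : continuous (fun z => facemin F (f z)).
  exact: comp_continuous cf (@facemin_continuous _ _ F).
have cx v : continuous (fun z => f z v).
  exact: comp_continuous cf (@ptws_eval_continuous V R v).
have csl i : continuous (fun z => slope (f z) i) by apply: sub_continuous.
have cm2 : continuous (fun z => facemin F (f z) ^+ 2).
  by under eq_fun do rewrite expr2; apply: mul_continuous.
have csp : continuous (fun z => spread (f z)).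
  apply: add_continuous.
    by apply: sum_continuous => i; under eq_fun do rewrite expr2; apply: mul_continuous.
  have cd : continuous (fun z => defect (f z)).
    apply: sub_continuous; first exact: const_continuous.
    by apply: sum_continuous => v.
  by under eq_fun do rewrite expr2; apply: mul_continuous.
apply: div_continuous => //; last exact: add_continuous.
apply: add_continuous.
  apply: mul_continuous => //; apply: mul_continuous cm.
  exact: const_continuous.
apply: mul_continuous; first exact: const_continuous.
exact: sub_continuous.
Qed.

End FacetSphere.

(** * Facets attached to a contractible complex *)

Section RealizationMaps.
Variables (R : realType) (V : finType).
Implicit Types (K L M : {set {set V}}).

Definition realize K (Z : Type) (F : Z -> {ptws V -> R})
    (FK : forall z, barycentric R K (F z)) : Z -> realization R K :=
  fun z => exist _ (F z) (mem_set (FK z)).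

Lemma realize_continuous K (Z : topologicalType) (F : Z -> {ptws V -> R})
    (FK : forall z, barycentric R K (F z)) :
  continuous F -> continuous (realize FK).
Proof. by move=> cF; apply: (@set_type_continuous _ _ _ (realize FK)). Qed.

Definition coords K (x : realization R K) : {ptws V -> R} := \val x.

Lemma coords_continuous K : continuous (@coords K).
Proof. exact: val_continuous. Qed.

Lemma coordsP K (x : realization R K) : barycentric R K (coords x).
Proof. exact: set_mem (valP x). Qed.

Lemma realization_compact K : is_complex K -> compact [set: realization R K].
Proof. by move=> Kc; apply: set_type_compact; apply: barycentric_compact. Qed.

(** The time-T map retracts |K| onto |M|, and the deformation run backwards joins it to the
    identity. *)
Lemma collapses_equivalent K M : is_complex K -> collapses K M ->
  total_equivalent R (realization R K) (realization R M).
Proof.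
move=> Kc KM; have [T [H [cH H0 HK HM Hid]]] := collapses_deformation R Kc KM.
have MK : M \subset K := collapses_subset KM.
have rP (x : realization R K) : barycentric R M (H (coords x, T%:R)).
  by apply: HM; first exact: coordsP.
have iP (x : realization R M) : barycentric R K (coords x).
  by have [x0 x1 xM] := coordsP x; split=> //; apply: (fintype.subsetP MK).
have hP (p : realization R K * R) :
    barycentric R K (H (coords p.1, T%:R * (1 - clamp p.2))).
  apply: HK; first exact: coordsP.
  rewrite mulr_ge0 // subr_ge0; have := clamp_itv p.2.
  by rewrite /= in_itv /= => /andP[].
exists (realize rP), (realize iP); split.
- apply: realize_continuous; apply: (comp_continuous _ cH).
  by apply: pair_continuous; [exact: coords_continuous|exact: const_continuous].
- by apply: realize_continuous; exact: coords_continuous.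
- exists (realize hP); split=> [|x|x]; last 2 first.
  + apply: val_inj => /=; rewrite clampE ?lexx ?ler01 //.
    by rewrite subr0 mulr1.
  + apply: val_inj => /=; rewrite clampE ?lexx ?ler01 //.
    by rewrite subrr mulr0 H0.
  apply: realize_continuous; apply: (comp_continuous _ cH); apply: pair_continuous.
    exact: comp_continuous (@fst_continuous _ _) (@coords_continuous K).
  apply: mul_continuous; first exact: const_continuous.
  apply: sub_continuous; first exact: const_continuous.
  exact: comp_continuous (@snd_continuous _ _) (@clamp_continuous R).
exists fst; split=> [|x|//]; first exact: fst_continuous.
by apply: val_inj => /=; rewrite Hid //; exact: coordsP.
Qed.

End RealizationMaps.

(** In the product of all copies, coordinate i of a point lifted from another copy is the base
    point. *)
Lemma wedge_lift_eq (k : nat) (X : topologicalType) (p0 : X) (i j : 'I_k) (a b : X) :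
    @wedge_lift 'I_k (fun=> X) (fun=> p0) i a = @wedge_lift 'I_k (fun=> X) (fun=> p0) j b -> a <> p0 ->
  i = j /\ a = b.
Proof.
move=> /(congr1 (@wedge_prod _ _ (fun=> p0))); rewrite /wedge_prod !wedge_lift_funE;
  try exact: wedge_prod_pointE.
move=> e ap0; have e' := congr1 (fun f => f i) e; rewrite dfwithin in e'.
have [ij|ji] := eqVneq i j; first by split=> //; move: e'; rewrite -ij dfwithin.
by move: e'; rewrite dfwithout // eq_sym.
Qed.

Section AttachedFacets.
Variables (R : realType) (V : finType) (d : nat).
Variables (K C : {set {set V}}).
Hypothesis K_complex : is_complex K.
Hypothesis CK : C \subset K.
Hypothesis C_card : {in C, forall F : {set V}, #|F| = d.+1}.
Hypothesis C_facet : forall F s, F \in C -> s \in K -> F \subset s -> s = F.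
Implicit Types (x : {ptws V -> R}) (F : {set V}).

Local Notation K' := (K :\: C)%SET.

Lemma facemin_off x F : barycentric R K x -> F \in C -> support x != F ->
  facemin F x = 0.
Proof.
move=> [x0 x1 xK] FC xF; apply: facemin_eq0 => //; apply: contra xF => h.
by apply/eqP; apply: C_facet.
Qed.

Lemma sum_facet x F : barycentric R K x -> support x = F -> \sum_(v in F) x v = 1.
Proof.
move=> [_ x1 _] xF; rewrite big_mkcond -[RHS]x1; apply: eq_bigr => v _.
by rewrite -xF mem_support; case: eqP.
Qed.

(* A retraction (x, t) |-> (shrink (x, t), retract_time (x, t)) of |K| x [0,1] *)
(* onto |K| x 0 together with |K'| x [0,1]: on a facet of C it is the central  *)
(* projection from the barycenter, where radius is 0; it is 1 on the boundary. *)
Definition core_mass x : R := \sum_(F in C) facemin F x.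

Definition radius x : R := 1 - d.+1%:R * core_mass x.

Definition scale (p : {ptws V -> R} * R) : R :=
  Num.max 1 ((1 + clamp p.2) * radius p.1).

(** On a facet, x splits into its core, the least coordinate repeated on every vertex, and a rest of
    mass [radius]. The rest grows by the factor 1 + t while the core decreases until it is
    exhausted; [scale] is then the total mass. On |K| at most one F has a nonzero term, so the sums
    glue the formulas for all facets. *)
Definition shrink (p : {ptws V -> R} * R) : {ptws V -> R} := fun v =>
  ((1 + clamp p.2) * (p.1 v - \sum_(F in C) (v \in F)%:R * facemin F p.1)
   + \sum_(F in C) (v \in F)%:R *
       Num.max 0 ((1 + clamp p.2) * facemin F p.1 - clamp p.2 / d.+1%:R)) / scale p.

Definition retract_time (p : {ptws V -> R} * R) : R :=
  Num.max 0 ((1 + clamp p.2) * radius p.1 - 1).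

Lemma scale_gt0 p : 0 < scale p.
Proof. by rewrite /scale lt_max ltr01. Qed.

Let ccl : continuous (fun p : {ptws V -> R} * R => clamp p.2).
Proof. exact: comp_continuous (@snd_continuous _ _) (@clamp_continuous R). Qed.

Let cmin F : continuous (fun p : {ptws V -> R} * R => facemin F p.1).
Proof. exact: comp_continuous (@fst_continuous _ _) (@facemin_continuous R V F). Qed.

Let c1cl : continuous (fun p : {ptws V -> R} * R => 1 + clamp p.2).
Proof. by apply: add_continuous ccl; exact: const_continuous. Qed.

Let cradius : continuous (fun p : {ptws V -> R} * R => (1 + clamp p.2) * radius p.1).
Proof.
apply: mul_continuous c1cl _; apply: sub_continuous; first exact: const_continuous.
apply: mul_continuous; first exact: const_continuous.
by apply: sum_continuous => F.
Qed.

Lemma retract_time_continuous : continuous retract_time.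
Proof.
apply: max_fun_continuous; first exact: const_continuous.
by apply: sub_continuous cradius _; exact: const_continuous.
Qed.

Lemma shrink_continuous : continuous shrink.
Proof.
apply: ptws_continuous => v; apply: div_continuous => [p||].
- by rewrite gt_eqF // scale_gt0.
- apply: add_continuous.
    apply: mul_continuous c1cl _; apply: sub_continuous.
      exact: comp_continuous (@fst_continuous _ _) (@ptws_eval_continuous V R v).
    apply: sum_continuous => F; apply: mul_continuous; last exact: cmin.
    exact: const_continuous.
  apply: sum_continuous => F; apply: mul_continuous; first exact: const_continuous.
  apply: max_fun_continuous; first exact: const_continuous.
  apply: sub_continuous; first exact: mul_continuous c1cl (@cmin F).
  by apply: mul_continuous ccl _; exact: const_continuous.
by apply: max_fun_continuous cradius; exact: const_continuous.
Qed.

Lemma retract_off x t : barycentric R K x -> support x \notin C ->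
  shrink (x, t) = x /\ retract_time (x, t) = clamp t.
Proof.
move=> xK xC; have mF F : F \in C -> facemin F x = 0.
  by move=> FC; apply: facemin_off => //; apply: contraNneq xC => ->.
have := clamp_itv t; rewrite /= in_itv /= => /andP[t0 t1].
have rE : radius x = 1 by rewrite /radius /core_mass big1 ?mulr0 ?subr0.
have sE : scale (x, t) = 1 + clamp t by rewrite /scale /= rE mulr1 max_r // lerDl.
split; last by rewrite /retract_time /= rE mulr1 addrC addKr max_r.
apply/funext => v; rewrite /shrink sE /= big1 => [|F /mF ->]; last by rewrite mulr0.
rewrite big1 => [|F /mF ->].
  by rewrite subr0 addr0 mulrAC divff ?mul1r // gt_eqF // ltr_pwDl.
by rewrite mulr0 sub0r max_l ?mulr0 // oppr_le0 divr_ge0.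
Qed.

(** While (1 + c) * radius is at most 1, the time is 0. Beyond that the core is used up, so a vertex
    of least coordinate leaves the support and the point lands in |K'|. *)
Lemma retract_on x t (F := support x) : barycentric R K x -> F \in C ->
  [/\ barycentric R K (shrink (x, t)), 0 <= retract_time (x, t),
      clamp t = 0 -> shrink (x, t) = x /\ retract_time (x, t) = 0
    & retract_time (x, t) = 0 \/ barycentric R K' (shrink (x, t))].
Proof.
move=> xK FC; have [x0 xs _] := xK.
have := clamp_itv t; rewrite /= in_itv /=; set c := clamp t => /andP[c0 c1].
have FK : F \in K := fintype.subsetP CK _ FC.
have m0 : 0 <= facemin F x := facemin_ge0 F x0.
have xF : \sum_(v in F) x v = 1 by apply: sum_facet.
have only (G : {set V} -> R) : (forall E, E \in C -> E != F -> G E = 0) ->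
    \sum_(E in C) G E = G F.
  move=> h; rewrite (bigD1 F) //= big1 ?addr0 // => E /andP[EC EF]; exact: h.
have off E : E \in C -> E != F -> facemin E x = 0.
  by move=> EC EF; apply: facemin_off => //; rewrite eq_sym.
have rE : radius x = 1 - d.+1%:R * facemin F x by rewrite /radius /core_mass only.
have dm : d.+1%:R * facemin F x <= 1.
  rewrite -[leRHS]xF -(C_card FC) mulr_natl -(sumr_const (mem F)).
  by apply: ler_sum => v vF; apply: facemin_le.
have d0 : d.+1%:R != 0 :> R by rewrite pnatr_eq0.
have shE v : shrink (x, t) v = ((1 + c) * (x v - (v \in F)%:R * facemin F x)
    + (v \in F)%:R * Num.max 0 ((1 + c) * facemin F x - c / d.+1%:R)) / scale (x, t).
  rewrite /shrink /= -/c !only // => E EC EF; rewrite off ?mulr0 //.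
  by rewrite sub0r max_l ?mulr0 // oppr_le0 divr_ge0.
have sp := scale_gt0 (x, t).
have pos v : 0 <= x v - (v \in F)%:R * facemin F x.
  have [vF|vF] := boolP (v \in F); last by rewrite mul0r subr0.
  by rewrite mul1r subr_ge0 facemin_le.
have c10 : 0 <= 1 + c by rewrite addr_ge0.
have sh0 v : 0 <= shrink (x, t) v.
  rewrite shE; apply: divr_ge0; last exact: ltW.
  apply: addr_ge0; apply: mulr_ge0 => //.
  by rewrite le_max lexx.
have cntF : \sum_v (v \in F)%:R = d.+1%:R :> R.
  rewrite -(C_card FC) -[RHS](sumr_const (mem F) 1) [RHS]big_mkcond /=.
  by apply: eq_bigr => v _; case: (v \in F).
have scE : scale (x, t) = (1 + c) * radius x + d.+1%:R *
    Num.max 0 ((1 + c) * facemin F x - c / d.+1%:R).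
  have -> : d.+1%:R * Num.max 0 ((1 + c) * facemin F x - c / d.+1%:R) =
      Num.max 0 (1 - (1 + c) * radius x).
    rewrite maxr_pMr // mulr0 rE; congr Num.max.
    by move: (d.+1%:R) d0 => a d0; field.
  rewrite /scale /= -/c; case: (leP 1 ((1 + c) * radius x)) => h.
    by rewrite max_l ?addr0 // subr_le0.
  by rewrite max_r ?subrKC // subr_ge0 ltW.
have sh1 : \sum_v shrink (x, t) v = 1.
  rewrite (eq_bigr _ (fun v _ => shE v)) -mulr_suml big_split /= -mulr_sumr.
  rewrite big_split /= sumrN xs -!mulr_suml cntF -rE -scE.
  by rewrite divff // gt_eqF.
have shS : support (shrink (x, t)) \subset F.
  apply/fintype.subsetP => v; rewrite mem_support; apply: contraNT => vF.
  have : v \notin support x by [].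
  rewrite mem_support negbK => /eqP xv.
  by rewrite shE xv (negPf vF) !mul0r subrr mulr0 addr0 mul0r.
have shK : barycentric R K (shrink (x, t)) by apply: barycentric_face shS.
split=> //.
- by rewrite le_max lexx.
- move=> ct0; have rt : retract_time (x, t) = 0.
    rewrite /retract_time /= -/c ct0 addr0 mul1r max_l // rE subr_le0 gerBl.
    by rewrite mulr_ge0.
  split=> //; apply/funext => v; rewrite shE scE ct0 mul0r subr0 addr0 !mul1r max_r //.
  by rewrite rE !subrK divr1.
have [le1|gt1] := leP ((1 + c) * radius x) 1.
  by left; rewrite /retract_time /= -/c max_l // subr_le0.
right; split=> //; rewrite -/(support _).
have F0 : F != finset.set0 by rewrite -card_gt0 (C_card FC).
have [w wF mw] := facemin_attained F0 (fun v => barycentric_le1 v xK).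
have mz : Num.max 0 ((1 + c) * facemin F x - c / d.+1%:R) = 0.
  rewrite max_l // subr_le0 ler_pdivlMr ?ltr0Sn //.
  move: gt1; rewrite rE; set a := d.+1%:R; set m := facemin F x; lra.
have wS : w \notin support (shrink (x, t)).
  by rewrite mem_support negbK shE mz mulr0 addr0 wF mul1r mw subrr mulr0 mul0r.
have [_ _ shSK] := shK.
rewrite inE shSK andbT; apply: contra wS => SC.
by rewrite -(C_facet SC FK shS).
Qed.

Lemma noncritical_part_complex : is_complex K'.
Proof.
have [K0 Kd] := K_complex; split=> [|s t]; first by rewrite inE (negPf K0) andbF.
rewrite !inE => /andP[sC sK] ts t0; rewrite (Kd s t) // andbT.
by apply: contra sC => tC; rewrite (C_facet tC sK ts).
Qed.

Let k := #|C|.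

Definition facet (i : 'I_k) : {set V} := enum_val i.

Lemma facet_in i : facet i \in C. Proof. exact: enum_valP. Qed.

Lemma facet_inj : injective facet. Proof. exact: enum_val_inj. Qed.

Lemma facetP F : F \in C -> exists i, facet i = F.
Proof. by move=> FC; exists (enum_rank_in FC F); rewrite /facet enum_rankK_in. Qed.

Let card_facet i : #|facet i| = d.+1 := C_card (facet_in i).

Implicit Types (X : realization R K).

Lemma mass_facet x i : barycentric R K x -> 0 < facemin (facet i) x ->
  \sum_(v in facet i) x v = 1.
Proof.
move=> xK mgt; apply: sum_facet => //; apply/eqP; apply: contraTT mgt => h.
by rewrite (facemin_off xK (facet_in i)) ?ltxx.
Qed.

Lemma facet_map_on_sphere i X : sphere R d (facet_sphere (card_facet i) (coords X)).
Proof.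
have XK := coordsP X; apply: facet_sphere_on_sphere => [v|v|].
- exact: barycentric_ge0 XK.
- exact: barycentric_le1 XK.
- exact: mass_facet.
Qed.

Definition facet_map (i : 'I_k) X : sphere R d :=
  exist (fun y => y \in sphere R d) _ (mem_set (facet_map_on_sphere i X)).

Lemma facet_map_continuous i : continuous (facet_map i).
Proof.
apply: (@set_type_continuous _ _ _ (facet_map i)).
apply: facet_sphere_continuous; first exact: coords_continuous.
move=> X; rewrite gt_eqF //; have XK := coordsP X; apply: denominator_gt0.
- by move=> v; exact: barycentric_ge0 XK.
- by move=> v; exact: barycentric_le1 XK.
Qed.

Lemma facet_map_off i X : support (coords X) != facet i -> facet_map i X = sphere_point R d.
Proof.
move=> h; have XK := coordsP X; apply: val_inj => /=; apply: facet_sphere_pole.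
- by move=> v; exact: barycentric_ge0 XK.
- by move=> v; exact: barycentric_le1 XK.
- by apply: facemin_off XK _ h; exact: facet_in.
Qed.

Lemma facet_map_on i X : support (coords X) = facet i -> facet_map i X <> sphere_point R d.
Proof.
move=> h /(congr1 val)/= /eqP; have XK := coordsP X.
have X0 v : 0 <= coords X v by exact: barycentric_ge0 XK.
apply/negP; apply: facet_sphere_not_pole => //.
- by move=> v; exact: barycentric_le1 XK.
- by rewrite facemin_gt0 // h.
Qed.

Lemma facet_map_inj i X Y : support (coords X) = facet i ->
  support (coords Y) = facet i -> facet_map i X = facet_map i Y -> X = Y.
Proof.
move=> sX sY /(congr1 val)/= e; have XK := coordsP X; have YK := coordsP Y.
have [X0 X1 _] := XK; have [Y0 Y1 _] := YK; apply: val_inj.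
apply: (facet_sphere_inj (cF := card_facet i)) => // v.
  exact: barycentric_le1 XK.
exact: barycentric_le1 YK.
Qed.

Lemma facet_map_surj i (s : sphere R d) : s <> sphere_point R d ->
  exists2 X, support (coords X) = facet i & facet_map i X = s.
Proof.
move=> sp; have sS : sphere R d (\val s) := set_mem (valP s).
have snp : \val s != delta_mx 0 ord0.
  by apply/eqP => e; apply: sp; apply: val_inj.
have [x [x0 x1 sx ex]] := facet_sphere_surj (card_facet i) sS snp.
have xK : barycentric R K x.
  by split=> //; rewrite -/(support x) sx (fintype.subsetP CK) // facet_in.
exists (exist _ x (mem_set xK)) => //.
exact: val_inj.
Qed.

Section Wedge.
Variable i0 : 'I_k.

Notation W := (wedge_of_spheres R k d).

Definition to_wedge (i : 'I_k) (s : sphere R d) : W :=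
  @wedge_lift 'I_k _ (fun=> sphere_point R d) i s.

Lemma to_wedge_pole i j : to_wedge i (sphere_point R d) = to_wedge j (sphere_point R d).
Proof.
exact: (@wedge_liftE 'I_k (fun=> sphere R d) (fun=> sphere_point R d)
  j (sphere_point R d) i (sphere_point R d)).
Qed.

Definition collapse_map X : W :=
  if [pick i | support (coords X) == facet i] is Some i then to_wedge i (facet_map i X)
  else to_wedge i0 (sphere_point R d).

Lemma collapse_map_on i X : support (coords X) = facet i ->
  collapse_map X = to_wedge i (facet_map i X).
Proof.
move=> e; rewrite /collapse_map; case: pickP => [j|/(_ i)]; rewrite e ?eqxx //.
by move/eqP/facet_inj => ->.
Qed.

Lemma collapse_map_off X : support (coords X) \notin C ->
  collapse_map X = to_wedge i0 (sphere_point R d).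
Proof.
move=> e; rewrite /collapse_map; case: pickP => // j /eqP ej.
by move: e; rewrite ej facet_in.
Qed.

(** Inside an open facet the map is locally a single facet map. Elsewhere all of the finitely many
    facet maps are at the pole, so near such a point all of them lie in a given neighbourhood of the
    base point. *)
Lemma collapse_map_continuous : continuous collapse_map.
Proof.
have cwm i : continuous (fun X => to_wedge i (facet_map i X)).
  apply: (comp_continuous (@facet_map_continuous i)).
  exact: (@wedge_lift_continuous _ _ (fun=> sphere_point R d) i).
move=> X U /= nU; have [/facetP[i ei]|XC] := boolP (support (coords X) \in C).
  have open_near : \forall Y \near X, 0 < facemin (facet i) (coords Y).
    have cm : continuous (fun Y : realization R K => facemin (facet i) (coords Y)).
      exact: comp_continuous (@coords_continuous R V K) (@facemin_continuous R V _).
    have Xpos : 0 < facemin (facet i) (coords X).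
      by rewrite facemin_gt0 ?ei // => v; exact: barycentric_ge0 (coordsP X).
    exact: (cvgr_gt _ (cm X) _ Xpos).
  rewrite (collapse_map_on (esym ei)) in nU; have nU' := cwm i X U nU.
  apply: filterS2 open_near nU' => Y Ypos YU; rewrite /= (@collapse_map_on i) //.
  have YK := coordsP Y; apply/eqP; apply: contraTT Ypos => h.
  by rewrite (facemin_off YK (facet_in i)) ?ltxx.
rewrite collapse_map_off // in nU.
have near_all : \forall Y \near X, forall i, U (to_wedge i (facet_map i Y)).
  have := @filter_forall (realization R K) 'I_k
    (fun i Y => U (to_wedge i (facet_map i Y))) (nbhs X) (nbhs_filter X).
  apply => i.
  apply: (cwm i X U).
  rewrite facet_map_off; first by rewrite (to_wedge_pole i i0).
  by apply: contraNneq XC => ->; exact: facet_in.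
have nU0 : U (to_wedge i0 (sphere_point R d)) by exact: nbhs_singleton nU.
move: near_all; apply: filterS => Y YU; rewrite /=.
have [/facetP[i ei]|YC] := boolP (support (coords Y) \in C).
  by rewrite (collapse_map_on (esym ei)).
by rewrite collapse_map_off.
Qed.

Lemma collapse_map_inj X Y : collapse_map X = collapse_map Y -> X = Y \/
  support (coords X) \notin C /\ support (coords Y) \notin C.
Proof.
have [/facetP[i ei]|XC] := boolP (support (coords X) \in C); last first.
  have [/facetP[j ej]|YC] := boolP (support (coords Y) \in C); last by right.
  rewrite collapse_map_off // (collapse_map_on (esym ej)) => /esym/wedge_lift_eq[|_ e].
    exact: facet_map_on (esym ej).
  by case: (facet_map_on (esym ej) e).
rewrite (collapse_map_on (esym ei)).
have [/facetP[j ej]|YC] := boolP (support (coords Y) \in C); last first.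
  rewrite collapse_map_off // => /wedge_lift_eq[|_ e].
    exact: facet_map_on (esym ei).
  by case: (facet_map_on (esym ei) e).
rewrite (collapse_map_on (esym ej)) => /wedge_lift_eq[|ij e].
  exact: facet_map_on (esym ei).
by left; rewrite -ij in e ej; exact: facet_map_inj (esym ei) (esym ej) e.
Qed.

Lemma collapse_map_surj (X0 : realization R K) : support (coords X0) \notin C ->
  forall w : W, exists X, collapse_map X = w.
Proof.
move=> X0C w; have : [set: W] w by [].
rewrite -wedgeTE => -[i _ [s _ <-]].
have [->|sp] := pselect (s = sphere_point R d).
  by exists X0; rewrite collapse_map_off //; exact: to_wedge_pole.
have [X sX <-] := facet_map_surj i sp; exists X.
exact: collapse_map_on.
Qed.

Lemma sphere_hausdorff : hausdorff_space (sphere R d).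
Proof. by apply: set_type_hausdorff; exact: norm_hausdorff. Qed.

(** Homotopy extension: composed with the retraction, the deformation of |K'| to a point extends to
    |K|, so [quotient_equivalent] may collapse |K'|; [collapse_map] identifies the quotient with the
    wedge. *)
Lemma attached_facets_wedge v0 : collapses K' [set [set v0]]%SET ->
  total_equivalent R (realization R K) W.
Proof.
move=> coll; have K'c := noncritical_part_complex.
have [T [H [cH H0 HK HM Hid]]] := collapses_deformation R K'c coll.
have v0K : [set v0]%SET \in K'.
  by apply: (fintype.subsetP (collapses_subset coll)); rewrite inE.
have K'K x : barycentric R K' x -> barycentric R K x.
  by case=> x0 x1; rewrite inE => /andP[_ xK].
have K'P x : barycentric R K x -> support x \notin C -> barycentric R K' x.
  by move=> [x0 x1 xK] xC; split=> //; rewrite inE xC.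
(* H is the identity at time 0, even off |K'|; at positive times the shrunk point lies in |K'|. *)
pose h0 (p : realization R K * R) := H (shrink (coords p.1, p.2),
  T%:R * retract_time (coords p.1, p.2)).
have h0A X t : support (coords X) \notin C -> h0 (X, t) = H (coords X, T%:R * clamp t).
  by move=> XC; rewrite /h0 /=; have [-> ->] := retract_off t (coordsP X) XC.
have hK p : barycentric R K (h0 p).
  case: p => X t; have [XC|XC] := boolP (support (coords X) \in C); last first.
    rewrite h0A //; apply/K'K/HK; first exact: K'P (coordsP X) XC.
    by rewrite mulr_ge0 //; have := clamp_itv t; rewrite /= in_itv /= => /andP[].
  rewrite /h0 /=; have [shK r0 _ [->|shK']] := retract_on t (coordsP X) XC.
    by rewrite mulr0 H0.
  by apply/K'K/HK => //; rewrite mulr_ge0.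
pose point (v : V) : R := (v == v0)%:R.
have pointP x : barycentric R [set [set v0]]%SET x -> x = point.
  case=> x0 x1; rewrite inE => /eqP/finset.setP sx; have xv v : v != v0 -> x v = 0.
    by move=> vv0; apply/eqP/negbFE; have := sx v; rewrite !inE (negPf vv0).
  apply/funext => v; rewrite /point; have [->|vv0] := eqVneq v v0; last exact: xv.
  by move: x1; rewrite (bigD1 v0) //= big1 ?addr0.
have pK : barycentric R K point.
  have K1 : [set v0]%SET \in K by move: v0K; rewrite inE => /andP[].
  apply: (barycentric_face K_complex K1) => [v||].
  - by rewrite /point.
  - by rewrite (bigD1 v0) //= {1}/point eqxx big1 ?addr0 // => v /negPf h; rewrite /point h.
  - apply/fintype.subsetP => v; rewrite mem_support inE /point.
    by case: (v =P v0) => //=; rewrite eqxx.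
pose P0 : realization R K := exist _ point (mem_set pK).
have P0C : support (coords P0) \notin C.
  have -> : support (coords P0) = [set v0]%SET.
    apply/finset.setP => v; rewrite mem_support inE -[coords P0 v]/(point v) /point.
    by case: (v =P v0) => _ /=; rewrite ?oner_eq0 ?eqxx.
  by move: v0K; rewrite inE => /andP[].
apply: (quotient_equivalent (q := collapse_map) (h := realize hK)
  (A := fun X => support (coords X) \notin C) (p := P0)).
- exact: realization_compact.
- by apply: wedge_hausdorff => _; exact: sphere_hausdorff.
- exact: collapse_map_continuous.
- exact: collapse_map_surj P0C.
- exact: collapse_map_inj.
- by move=> X Y XC YC; rewrite !collapse_map_off.
- apply: realize_continuous; apply: (comp_continuous _ cH).
  have cpt : continuous (fun p : realization R K * R => (coords p.1, p.2)).
    apply: pair_continuous; last exact: snd_continuous.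
    exact: comp_continuous (@fst_continuous _ _) (@coords_continuous R V K).
  apply: pair_continuous; first exact: comp_continuous cpt shrink_continuous.
  apply: mul_continuous; first exact: const_continuous.
  exact: comp_continuous cpt retract_time_continuous.
- move=> X; apply: val_inj => /=; have c0 : clamp 0 = 0 :> R by rewrite clampE ?lexx ?ler01.
  have [XC|XC] := boolP (support (coords X) \in C).
    by rewrite /h0 /=; have [_ _ /(_ c0)[-> ->] _] := retract_on 0 (coordsP X) XC;
       rewrite mulr0 H0.
  by rewrite h0A // c0 mulr0 H0.
- move=> X t t01 XC; rewrite /realize /coords /= h0A //.
  have : barycentric R K' (H (coords X, T%:R * clamp t)).
    apply: HK; first exact: K'P (coordsP X) XC.
    by rewrite clampE // mulr_ge0 //; case/andP: t01.
  by case=> _ _; rewrite inE => /andP[].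
move=> X XC; apply: val_inj => /=; rewrite h0A // clampE ?lexx ?ler01 // mulr1.
by apply: pointP; apply: HM => //; exact: K'P (coordsP X) XC.
Qed.

End Wedge.
End AttachedFacets.

(** * The complex of strong Morse matchings *)

Section StarRealization.
Variables (R : realType) (n : nat).
Hypothesis n_gt0 : (0 < n)%N.

Notation I := 'I_n.+1.

(** A forest on n.+1 vertices has at most n arcs, and the star at [ord0] attains this. *)
Lemma star_complex_dim : has_dim (star_complex I) n.-1.
Proof.
rewrite star_complex_forests; split=> [|_ /imsetP[E EF ->]]; last first.
  rewrite card_imset; last exact: arc_pair_inj.
  have /forestsP[_ fE] := EF; rewrite prednK //.
  by have := card_forest_le ord0 fE; rewrite card_ord.
have := card_star (ord0 : I); rewrite card_ord /= => cE.
have := star_rooted_forest (ord0 : I); move: cE; set E := imset _ _ => cE fE.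
exists (@arc_pair I @: E)%SET; last first.
  by rewrite card_imset ?cE ?prednK //; exact: arc_pair_inj.
rewrite mem_image_complex; last exact: arc_pair_inj.
by apply/forestsP; split=> //; rewrite -card_gt0 cE.
Qed.

Lemma star_complex_wedge :
  total_equivalent R (realization R (star_complex I)) (wedge_of_spheres R (n ^ n) n.-1).
Proof.
have v1z : (ord_max : I) != ord0 by rewrite -val_eqE /= -lt0n.
pose f := @arc_pair I; have f_inj : injective f := @arc_pair_inj I.
pose C : {set {set ({set I} * {set I})}} := image_complex f (critical (ord0 : I)).
have cC : #|C| = (n ^ n)%N.
  by rewrite card_imset ?(card_critical v1z) ?card_ord //; exact: imset_inj.
have i0 : 'I_#|C| by apply: (@Ordinal _ 0); rewrite cC expn_gt0 n_gt0.
rewrite -cC; have sC : critical (ord0 : I) \subset forests I.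
  by apply/fintype.subsetP => E; rewrite inE => /andP[].
apply: (@attached_facets_wedge R _ n.-1 (star_complex I) C _ _ _ _ i0
  (f (ord0, first_other ord0 ord_max))).
- exact: star_complex_is_complex.
- by rewrite star_complex_forests; apply: imsetS.
- move=> _ /imsetP[E Ec ->]; rewrite card_imset //.
  by rewrite (card_critical_face Ec) card_ord prednK.
- move=> _ s /imsetP[E Ec ->]; rewrite star_complex_forests => /imsetP[E' E'F ->] EE'.
  have /forestsP[_ fE'] := E'F; apply/eqP; rewrite eq_sym eqEcard EE' !card_imset //.
  by rewrite (card_critical_face Ec) (card_forest_le ord0).
have -> : (star_complex I :\: C)%SET = image_complex f (forests I :\: critical ord0)%SET.
  rewrite star_complex_forests; apply/finset.setP => s; apply/idP/imsetP.
    rewrite inE => /andP[sC' /imsetP[E EF es]]; exists E => //.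
    by rewrite inE EF andbT; apply: contra sC' => Ec; rewrite es mem_image_complex.
  case=> E; rewrite inE => /andP[Ec EF] ->.
  by rewrite inE !mem_image_complex // Ec.
have -> : [set [set f (ord0, first_other ord0 ord_max)]]%SET =
    image_complex f (base_face ord0 ord_max).
  by rewrite /image_complex /base_face !imset_set1.
by apply: collapses_image => //; exact: noncritical_collapses.
Qed.

End StarRealization.

Theorem theorem9p3 (R : realType) (n : nat) (hn : (1 <= n)%N) :
  (exists X : {set {set {set 'I_n.+1} * {set 'I_n.+1}}},
    [/\ is_subcomplex X (SM R (full_simplex 'I_n.+1)),
        collapses (SM R (full_simplex 'I_n.+1)) X,
        has_dim X n.-1
      & isomorphic X (forest_complex (complete_digraph n.+1))])
  /\
  homotopy_equivalent R
    (realization R (SM R (full_simplex 'I_n.+1)))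
    (wedge_of_spheres R (n ^ n)%N n.-1).
Proof.
rewrite SM_full_simplex; have coll := elim_complex_collapses (ord0 : 'I_n.+1).
split.
  exists (star_complex 'I_n.+1); split=> //.
  - by split; [exact: star_complex_is_complex|exact: star_complex_sub].
  - exact: star_complex_dim.
  rewrite star_complex_forests forest_complex_complete.
  by apply: (isomorphic_image_complex (ord0, ord0)); exact: arc_pair_inj.
apply: total_equivalent_homotopy_equivalent.
apply: total_equivalent_trans (star_complex_wedge R hn).
by apply: collapses_equivalent coll; exact: elim_complex_is_complex.
Qed.
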